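(* Let $P = \{x\in\mathbb{R}^n : \langle x,a_i\rangle \leq 1,\ 1\leq i\leq m\}$ be a centered $n$-dimensional polytope, given by its irredundant description, with facets $F_i = P\cap\{x\in\mathbb{R}^n:\langle a_i,x\rangle=1\}$ and cones $C_i=\mathrm{conv}(\{0\}\cup F_i)$ for $1\leq i\leq m$. Let $A\subseteq\mathbb{R}^n$ be an affine subspace. Then $$\sum_{i:\,a_i\in A} \mathrm{vol}(C_i)\leq \frac{\dim A+1}{n+1}\,\mathrm{vol}(P).$$
   Context: A polytope is the convex hull of a finite set of points in $\mathbb{R}^n$. Every $n$-dimensional polytope $P\subset\mathbb{R}^n$ with $0$ in its interior has a unique (irredundant) representation $P=\{x\in\mathbb{R}^n:\langle a_i,x\rangle\leq 1,\ 1\leq i\leq m\}$, where the $a_i\in\mathbb{R}^n\setminus\{0\}$ are pairwise different and the sets $F_i=P\cap\{x:\langle a_i,x\rangle=1\}$ are exactly the facets (the $(n-1)$-dimensional faces) of $P$. The polytope $P$ is called centered if its centroid $\mathrm{c}(P)=\mathrm{vol}(P)^{-1}\int_P x\,dx$ equals $0$ (then $0$ is an interior point of $P$). $\mathrm{vol}$ is $n$-dimensional Lebesgue measure. *)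

(* Defs.v *)
From HB Require Import structures.
From mathcomp Require Import all_boot all_order all_algebra.
From mathcomp Require Import all_classical all_reals all_analysis.

Set Implicit Arguments.
Unset Strict Implicit.
Unset Printing Implicit Defensive.
Import Order.TTheory GRing.Theory Num.Theory.
Import numFieldNormedType.Exports.
Local Open Scope classical_set_scope.
Local Open Scope ring_scope.

Definition measure_rV_display : measure_display.
Proof. exact: default_measure_display. Qed.

Section measurable_rV.
Context {R : realType} {n : nat}.

Let coord : 'I_n -> 'rV[R]_n -> R := fun i x => x ord0 i.

Let rV_set0 : g_sigma_preimage coord set0.
Proof. exact: sigma_algebra0. Qed.

Let rV_setC A : g_sigma_preimage coord A -> g_sigma_preimage coord (~` A).
Proof. exact: sigma_algebraC. Qed.

Let rV_bigcup (F : (set 'rV[R]_n)^nat) :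
  (forall i, g_sigma_preimage coord (F i)) ->
  g_sigma_preimage coord (\bigcup_i (F i)).
Proof. exact: sigma_algebra_bigcup. Qed.

(* The product sigma-algebra, as for n.-tuple; on R^n it is the Borel one. *)
HB.instance Definition _ := @isMeasurable.Build measure_rV_display
  'rV[R]_n (g_sigma_preimage coord) rV_set0 rV_setC rV_bigcup.

End measurable_rV.

Section measurable_fun_rV.
Context {R : realType}.

Lemma measurable_coord n (i : 'I_n) :
  measurable_fun [set: 'rV[R]_n] (fun x : 'rV[R]_n => x ord0 i).
Proof.
move=> _ Y mY; rewrite setTI; apply: sub_sigma_algebra => /=.
rewrite -bigcup_seq/=; exists i => /=; first by rewrite mem_index_enum.
by exists Y => //; rewrite setTI.
Qed.

Lemma measurable_fun_rVP d (T : measurableType d) n (f : T -> 'rV[R]_n) :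
  measurable_fun [set: T] f <->
  forall i, measurable_fun [set: T] (fun t => f t ord0 i).
Proof.
split=> [mf i|mf].
  exact: (measurableT_comp (measurable_coord i) mf).
move=> _ Y mY; rewrite setTI.
suff : [set A | measurable (f @^-1` A)] Y by [].
apply: (smallest_sub _ _ mY) => [|A] /=.
  split=> [|A /= mA|F /= mF]; first by rewrite /= preimage_set0.
    by rewrite setTD preimage_setC; exact: measurableC.
  by rewrite preimage_bigcup; exact: bigcupT_measurable.
rewrite -bigcup_seq/= => -[i /= _ [B mB <-]].
by rewrite setTI -[X in measurable X]setTI; exact: (mf i).
Qed.

Lemma measurable_rV_box n (B : 'I_n -> set R) : (forall i, measurable (B i)) ->
  measurable [set x : 'rV[R]_n | forall i, B i (x ord0 i)].
Proof.
move=> mB; have -> : [set x : 'rV[R]_n | forall i, B i (x ord0 i)] =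
    \bigcap_(i in [set: 'I_n]) (fun x : 'rV[R]_n => x ord0 i) @^-1` B i.
  by apply/seteqP; split=> [x Bx i _|x Bx i]; [exact: Bx|exact: (Bx i)].
apply: fin_bigcap_measurable => // i _.
by rewrite -[X in measurable X]setTI; exact: measurable_coord.
Qed.

Definition rV_cons n (p : measurableTypeR R * 'rV[R]_n) : 'rV[R]_n.+1 :=
  row_mx (p.1)%:M p.2.

Definition rV_uncons n (x : 'rV[R]_n.+1) : measurableTypeR R * 'rV[R]_n :=
  (@lsubmx R 1 1 n x ord0 ord0, @rsubmx R 1 1 n x).

Lemma rV_consK n : cancel (@rV_cons n) (@rV_uncons n).
Proof. by case=> x v; rewrite /rV_uncons row_mxKl row_mxKr mxE eqxx mulr1n. Qed.

Lemma rV_unconsK n : cancel (@rV_uncons n) (@rV_cons n).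
Proof.
move=> x; rewrite /rV_cons /= (_ : _%:M = @lsubmx R 1 1 n x).
  exact: (@hsubmxK R 1 1 n x).
by apply/matrixP => i j; rewrite !ord1 !mxE eqxx mulr1n.
Qed.

Lemma rV_cons0 n p : @rV_cons n p ord0 ord0 = p.1.
Proof.
rewrite (_ : @rV_cons n p ord0 ord0 = row_mx (p.1)%:M p.2 ord0 (lshift n ord0)).
  by rewrite row_mxEl mxE eqxx mulr1n.
by congr (row_mx _ _ _ _); exact: val_inj.
Qed.

Lemma rV_consS n p i : @rV_cons n p ord0 (lift ord0 i) = p.2 ord0 i.
Proof.
rewrite (_ : @rV_cons n p ord0 (lift ord0 i) =
  row_mx (p.1)%:M p.2 ord0 (rshift 1 i)); first by rewrite row_mxEr.
by congr (row_mx _ _ _ _); exact: val_inj.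
Qed.

Lemma measurable_rV_cons n : measurable_fun setT (@rV_cons n).
Proof.
apply/measurable_fun_rVP => i; case: (unliftP ord0 i) => [j|] ->.
  under eq_fun do rewrite rV_consS.
  exact: (measurableT_comp (measurable_coord j) measurable_snd).
under eq_fun do rewrite rV_cons0.
exact: measurable_fst.
Qed.

Lemma measurable_rV_uncons n : measurable_fun setT (@rV_uncons n).
Proof.
apply/measurable_fun_pairP; split.
  rewrite (_ : _ \o _ = fun x : 'rV[R]_n.+1 => x ord0 (@lshift 1 n ord0)).
    exact: measurable_coord.
  by apply/funext => x /=; rewrite mxE.
apply/measurable_fun_rVP => i.
rewrite (_ : (fun _ => _) = fun x : 'rV[R]_n.+1 => x ord0 (@rshift 1 n i)).
  exact: measurable_coord.
by apply/funext => x /=; rewrite mxE.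
Qed.

End measurable_fun_rV.

(* Lebesgue measure on R^n, as the n-fold product of that on R. *)
Section lebesgue_measure_rV.
Context {R : realType}.
Local Open Scope ereal_scope.

Section step.
Variables (n : nat) (mu : {sigma_finite_measure set 'rV[R]_n -> \bar R}).

Definition lebesgue_rV_step : set 'rV[R]_n.+1 -> \bar R :=
  pushforward (@lebesgue_measure R \x mu) (@rV_cons R n).

Let step0 : lebesgue_rV_step set0 = 0.
Proof. by rewrite /lebesgue_rV_step /pushforward preimage_set0 measure0. Qed.

Let step_ge0 A : 0 <= lebesgue_rV_step A.
Proof. by rewrite /lebesgue_rV_step /pushforward. Qed.

Let step_sigma_additive : semi_sigma_additive lebesgue_rV_step.
Proof.
move=> F mF tF mUF; rewrite /lebesgue_rV_step /pushforward preimage_bigcup.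
have mcons A : measurable A -> measurable (@rV_cons R n @^-1` A).
  by move=> mA; rewrite -[X in measurable X]setTI; exact: measurable_rV_cons.
apply: measure_semi_sigma_additive => [k||].
- exact: mcons.
- apply/trivIsetP => i j _ _ ij; rewrite -preimage_setI.
  by move/trivIsetP : tF => /(_ _ _ _ _ ij) ->//; rewrite preimage_set0.
- by rewrite -preimage_bigcup; exact: mcons.
Qed.

HB.instance Definition _ := isMeasure.Build _ _ _ lebesgue_rV_step
  step0 step_ge0 step_sigma_additive.

Let step_sigma_finite : sigma_finite setT lebesgue_rV_step.
Proof.
have /sigma_finiteP[F [TF ndF Foo]] := sigma_finiteT (@lebesgue_measure R).
have /sigma_finiteP[G [TG ndG Goo]] := sigma_finiteT mu.
exists (fun k => @rV_uncons R n @^-1` (F k `*` G k)).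
  apply/seteqP; split=> // x _.
  have : [set: measurableTypeR R] (rV_uncons x).1 by [].
  have : [set: 'rV[R]_n] (rV_uncons x).2 by [].
  rewrite TF TG => -[k _ Gk] [l _ Fl]; exists (maxn l k) => //; split.
    by move: Fl; exact/subsetPset/ndF/leq_maxl.
  by move: Gk; exact/subsetPset/ndG/leq_maxr.
move=> k; have [mF Fk_oo] := Foo k; have [mG Gk_oo] := Goo k; split.
  rewrite -[X in measurable X]setTI; apply: measurable_rV_uncons => //.
  exact: measurableX.
rewrite /lebesgue_rV_step /pushforward -comp_preimage.
rewrite (_ : _ \o _ = id) ?preimage_id; last first.
  by apply/funext => p; exact: rV_consK.
by rewrite product_measure1E// lte_mul_pinfty// ge0_fin_numE.
Qed.

HB.instance Definition _ := Measure_isSigmaFinite.Build _ _ _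
  lebesgue_rV_step step_sigma_finite.

End step.

Fixpoint lebesgue_rV (n : nat) : {sigma_finite_measure set 'rV[R]_n -> \bar R} :=
  if n is n'.+1 then lebesgue_rV_step (lebesgue_rV n') else \d_(0%R : 'rV[R]_0).

Lemma lebesgue_rV_box n (B : 'I_n -> set R) : (forall i, measurable (B i)) ->
  lebesgue_rV n [set x : 'rV[R]_n | forall i, B i (x ord0 i)] =
  \prod_(i < n) lebesgue_measure (B i).
Proof.
elim: n B => [|n IH] B mB.
  by rewrite big_ord0 /= diracE mem_set//= => -[].
rewrite big_ord_recl -(IH (fun i => B (lift ord0 i)))//.
rewrite [LHS]/= /lebesgue_rV_step /pushforward -product_measure1E//; last first.
  exact: (measurable_rV_box (fun i => mB _)).
  exact: mB.
congr ((_ \x _) _); apply/seteqP; split=> [p Bp|p [Bp0 Bp] i] /=.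
  split=> [|i]; first by rewrite -(rV_cons0 p); exact: Bp.
  by rewrite -rV_consS; exact: Bp.
by case: (unliftP ord0 i) => [j|] ->; rewrite ?rV_consS ?rV_cons0//; exact: Bp.
Qed.

End lebesgue_measure_rV.

Section convex_geometry.
Context {R : realType} {n : nat}.
Implicit Types (u v c : 'rV[R]_n) (S P F A : set 'rV[R]_n).

Definition vol S : \bar R := lebesgue_rV n S.

Definition dotr u v : R := \sum_i u ord0 i * v ord0 i.

(* The empty set counts as an affine subspace; its dimension is -1. *)
Definition affine_subspace A : Prop :=
  A = set0 \/
  exists v (U : {vspace 'rV[R]_n}), A = [set v + u | u in [set` U]].

Definition affine_hull S := smallest affine_subspace S.

Definition affine_dim S : int :=
  xget (-1) [set d | exists v (U : {vspace 'rV[R]_n}),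
    affine_hull S = [set v + u | u in [set` U]] /\ d = (\dim U)%:Z].

Definition conv_hull S : set 'rV[R]_n :=
  smallest (@convex_set R 'rV[R]_n) S.

Definition polytope P : Prop := exists2 V, finite_set V & P = conv_hull V.

Definition face P F : Prop := exists c (b : R),
  (forall x, P x -> dotr c x <= b) /\ F = P `&` [set x | dotr c x = b].

Definition facet P F : Prop := face P F /\ affine_dim F = n%:Z - 1.

(* The integral is taken coordinatewise; polytopes have finite volume. *)
Definition centroid P : 'rV[R]_n :=
  (fine (vol P))^-1 *: \row_i (\int[lebesgue_rV n]_(x in P) x ord0 i).

Definition halfspaces m (a : 'I_m -> 'rV[R]_n) : set 'rV[R]_n :=
  [set x | forall i, dotr (a i) x <= 1].

Definition facet_of P c : set 'rV[R]_n := P `&` [set x | dotr c x = 1].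

Definition cone_of P c : set 'rV[R]_n := conv_hull ([set 0] `|` facet_of P c).

Record irredundant_description P m (a : 'I_m -> 'rV[R]_n) : Prop := {
  irredundant_neq0 : forall i, a i != 0 ;
  irredundant_inj : injective a ;
  irredundant_halfspaces : P = halfspaces a ;
  irredundant_facets : forall F, facet P F <-> exists i, F = facet_of P (a i)
}.

Lemma affine_hull_id A : affine_subspace A -> affine_hull A = A.
Proof. exact: smallest_id. Qed.

Lemma affine_dim_translate v (U : {vspace 'rV[R]_n}) :
  affine_dim [set v + u | u in [set` U]] = (\dim U)%:Z.
Proof.
have aff : affine_subspace [set v + u | u in [set` U]] by right; exists v, U.
rewrite /affine_dim affine_hull_id//.
case: xgetP => [d _ [w [W [eqUW ->]]]|/(_ (\dim U)%:Z)]; last first.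
  by case; exists v, U.
congr (\dim _)%:Z; apply/vspaceP => x.
have /seteqP[UW WU] := eqUW.
have [u0 u0W vE] : [set w + u | u in [set` W]] v.
  by apply: UW; exists 0; rewrite ?addr0//= mem0v.
apply/idP/idP => xin.
- have [y yU] : [set v + u | u in [set` U]] (w + (u0 + x)).
    by apply: WU; exists (u0 + x) => //=; rewrite memvD.
  by rewrite addrA vE => /addrI <-.
- have [y yW] : [set w + u | u in [set` W]] (v + x) by apply: UW; exists x.
  rewrite -vE -addrA => /addrI yE.
  have -> : x = y - u0 by rewrite yE addrC addrK.
  exact: memvB.
Qed.

Lemma affine_dim0 : affine_dim set0 = -1.
Proof.
rewrite /affine_dim affine_hull_id; last by left.
case: xgetP => // d _ [v [U [/esym/seteqP[U0 _] _]]].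
by have [] : set0 (v + 0); apply: U0; exists 0; rewrite //= mem0v.
Qed.

End convex_geometry.

(* Main.v *)
(* Let [K] be the cone over [P], [K = {(t, x) | <a_j, x> <= t for all j}], with the
   density [e^-t], and let [gap_i = t - <a_i, x>]. If [a_i] is in [A], then [gap_i]
   factors through the projection of [R^(n+1)] along the orthogonal of the linear
   span of [{(-1, b) | b in A}], a space of dimension [D = dim A + 1]. By
   Prekopa-Leindler the marginal [g] of the density on the quotient is log-concave,
   and comparing [g y * g v] with the values of [g] at two points of the segment
   [y, v] shows that, for independent [z], [w] distributed with this density,
     (1 - l)^D <= Prob (gap_i z >= l * gap_i w for all i with a_i in A).
   Over the cone spanned by [F_i], [gap_i z] is exponentially distributed, so that,
   at first order in [l], the complementary event has probability
   [\sum_i vol (C_i) / vol P * E gap_i], and [E gap_i = E t = n + 1] since [P] is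
   centered. Letting [l -> 0] gives the inequality. *)
Require Import Defs.
From HB Require Import structures.
From mathcomp Require Import all_boot all_order all_algebra.
From mathcomp Require Import all_classical all_reals all_analysis.
From mathcomp Require Import measurable_realfun ring lra.
Set Implicit Arguments.
Unset Strict Implicit.
Unset Printing Implicit Defensive.
Import Order.TTheory GRing.Theory Num.Theory.
Import numFieldNormedType.Exports.
Local Open Scope classical_set_scope.
Local Open Scope ring_scope.

(** * Lebesgue measure on the line *)

(** Homogenizing turns an affine subspace of dimension [D - 1] into a [D]-dimensional space of
    linear forms [(-1, b)], so only [D] directions matter. The density [e^-t] is log-linear, and a
    translation in height multiplies it by a constant; this makes [gap_i] memoryless over the cone
    spanned by [F_i]. The factor [(1 - l)^D] is the Jacobian of [y |-> l v + (1 - l) y] on the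
    quotient. The cones spanned by different facets are disjoint up to null sets. Hence
    [gap_i z < l * gap_i w] for some [i] with [a_i] in [A] has probability at least [\sum_i vol
    (C_i) / vol P * E (1 - e^(- l gap_i w))], and at most [1 - (1 - l)^D <= D l]. These two
    one-sided bounds suffice: divide by [l] and let [l] tend to [0]. The marginal [g] may a priori
    be infinite or fail to be smooth. So log-concavity is used only at midpoints, [l] runs through
    powers of [1/2], and most estimates are inequalities between nonnegative extended reals written
    without subtraction. *)

Section real_line.
Context {R : realType}.
Local Notation mu := (@lebesgue_measure R).
Local Open Scope ereal_scope.
Implicit Types (f g : measurableTypeR R -> \bar R).

Lemma measurable_affine (s c : R) :
  measurable_fun setT (fun x : measurableTypeR R => (s * x + c)%R : measurableTypeR R).
Proof. exact: measurable_funD. Qed.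

(** By uniqueness of Lebesgue measure: [s] times the pushforward gives half-open intervals their
    length. *)
Lemma lebesgue_measure_affine (s c : R) (A : set (measurableTypeR R)) :
  (0 < s)%R -> measurable A ->
  mu A = s%:E * pushforward mu (fun x => (s * x + c)%R : measurableTypeR R) A.
Proof.
move=> s0 mA.
pose m := measure_function_pushforward__canonical__measure_function_Measure mu (measurable_affine s c).
pose s' := NngNum (ltW s0).
rewrite (@lebesgue_measure_unique _ (mscale s' m))//= => _ [[a b]] _ <-.
rewrite /mscale/= /pushforward.
rewrite (_ : _ @^-1` _ = `]((a - c) / s)%R, ((b - c) / s)%R]%classic); last first.
  apply/seteqP; split=> x /=; rewrite !in_itv/= ?ltr_pdivrMr// ?ler_pdivlMr// => /andP[h1 h2];
   apply/andP; split; lra.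
rewrite !lebesgue_measure_itv/= !lte_fin ltr_pM2r ?invr_gt0// ltrD2r.
case: ifPn => ab; last by rewrite mule0.
rewrite -!EFinD -EFinM; congr EFin; field; exact: lt0r_neq0.
Qed.

Lemma integral_affine (s c : R) f : (0 < s)%R -> measurable_fun setT f -> (forall x, 0 <= f x) ->
  \int[mu]_x f x = s%:E * \int[mu]_x f (s * x + c)%R.
Proof.
move=> s0 mf f0.
pose m := measure_function_pushforward__canonical__measure_function_Measure mu (measurable_affine s c).
pose s' := NngNum (ltW s0).
transitivity (s%:E * \int[m]_x f x).
  rewrite (@eq_measure_integral _ _ _ _ (mscale s' m)); last first.
    by move=> A mA _; exact: lebesgue_measure_affine.
  by rewrite ge0_integral_mscale.
by congr (_ * _); exact: (ge0_integral_pushforward (measurable_affine s c) mu measurableT).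
Qed.

Lemma integral_shift (c : R) f : measurable_fun setT f -> (forall x, 0 <= f x) ->
  \int[mu]_x f (x + c)%R = \int[mu]_x f x.
Proof.
move=> mf f0; rewrite [RHS](integral_affine c (s := 1))// mul1e.
by apply: eq_integral => x _; rewrite mul1r.
Qed.

End real_line.

(** * The layer-cake formula and comparison of superlevel sets *)

Section layer_cake.
Context d (T : measurableType d) {R : realType}.
Variable m : {sigma_finite_measure set T -> \bar R}.
Local Notation mu := (@lebesgue_measure R).
Local Open Scope ereal_scope.

(** Tonelli on the region [0 < r < f x]: its section at [x] is an interval of length [f x], also
    when [f x] is infinite. *)
Lemma layer_cake (f : T -> \bar R) : measurable_fun setT f -> (forall x, 0 <= f x) ->
  \int[m]_x f x = \int[mu]_(r in `]0%R, +oo[) m [set x | r%:E < f x].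
Proof.
move=> mf f0.
pose A := [set p : T * measurableTypeR R | (0 < p.2)%R /\ (p.2)%:E < f p.1].
have mA : measurable A.
  rewrite (_ : A = (setT `&` [set p : T * measurableTypeR R | 0%:E < (p.2)%:E]) `&`
     (setT `&` [set p : T * measurableTypeR R | (p.2)%:E < f p.1])); last first.
    by rewrite /A; apply/seteqP; split=> -[x r]/=; rewrite lte_fin => -[]; tauto.
  by apply: measurableI; apply: measurable_lte => //;
    [exact/measurable_EFinP|exact/measurable_EFinP|exact: measurableT_comp].
transitivity (\int[m]_x \int[mu]_r (\1_A (x, r))%:E).
  apply: eq_integral => x _.
  rewrite (_ : (fun r => (\1_A (x, r))%:E) = (fun r => (\1_(xsection A x) r)%:E)); last first.
    by apply/funext => r; rewrite !indicE mem_xsection.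
  rewrite integral_indic ?setIT//; last exact: measurable_xsection.
  have := f0 x; case E : (f x) => [y| |]// => [|_].
    rewrite lee_fin => y0.
    rewrite (_ : xsection A x = `]0%R, y[%classic); last first.
      apply/seteqP; split=> r; rewrite /xsection/= inE /A/= in_itv/= E lte_fin.
        by move=> [-> ->].
      by move=> /andP[-> ->].
    rewrite [RHS](lebesgue_measure_itv `]0%R, y[)/= lte_fin; case: ifPn => [_|]; first by rewrite oppr0 addr0.
    by rewrite -leNgt => y0'; congr EFin; apply/le_anti/andP; split.
  rewrite (_ : xsection A x = `]0%R, +oo[%classic); last first.
    apply/seteqP; split=> r; rewrite /xsection/= inE /A/= in_itv/= E ltry ?andbT.
      by move=> [-> _].
    by move=> ->.
  by rewrite [RHS](lebesgue_measure_itv `]0%R, +oo[)/= ltry.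
rewrite (@fubini_tonelli _ _ _ _ _ m mu (fun p => (\1_A p)%:E))//; last first.
  exact/measurable_EFinP/measurable_indic.
rewrite [RHS]integral_mkcond; apply: eq_integral => r _.
rewrite (_ : (fun x => (\1_A (x, r))%:E) = (fun x => (\1_(ysection A r) x)%:E)); last first.
  by apply/funext => x; rewrite !indicE mem_ysection.
rewrite integral_indic ?setIT//; last exact: measurable_ysection.
rewrite patchE; case: ifPn => [|/negP]; rewrite inE/= in_itv/= andbT => r0.
  rewrite (_ : ysection A r = [set x | r%:E < f x])//; apply/seteqP; split=> x.
    by rewrite /ysection/= inE => -[].
  by rewrite /ysection/= inE.
rewrite (_ : ysection A r = set0) ?measure0//.
by apply/seteqP; split=> // x; rewrite /ysection/= inE => -[/r0].
Qed.

Lemma measurable_level (f : T -> \bar R) (r : \bar R) : measurable_fun setT f ->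
  measurable [set x | r < f x].
Proof.
by move=> mf; rewrite -[X in measurable X]setTI; exact: measurable_lte.
Qed.

Lemma measurable_level_measure (f : T -> \bar R) : measurable_fun setT f ->
  measurable_fun setT (fun r : measurableTypeR R => m [set x | r%:E < f x]).
Proof.
move=> mf.
pose A := [set p : T * measurableTypeR R | (p.2)%:E < f p.1].
have mA : measurable A.
  rewrite -[X in measurable X]setTI; apply: measurable_lte => //.
    exact/measurable_EFinP.
  exact: measurableT_comp.
have := measurable_fun_ysection m mA.
apply: eq_measurable_fun => r _; congr (m _).
by apply/seteqP; split=> x; rewrite /ysection/= ?inE.
Qed.

Lemma le_integral_level (f g : T -> \bar R) :
  measurable_fun setT f -> (forall x, 0 <= f x) ->
  measurable_fun setT g -> (forall x, 0 <= g x) ->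
  (forall r, (0 < r)%R -> m [set x | r%:E < f x] <= m [set x | r%:E < g x]) ->
  \int[m]_x f x <= \int[m]_x g x.
Proof.
move=> mf f0 mg g0 fg; rewrite !layer_cake//; apply: ge0_le_integral => //.
- by apply: measurable_funTS; exact: measurable_level_measure.
- by apply: measurable_funTS; exact: measurable_level_measure.
- by move=> r /=; rewrite in_itv/= andbT; exact: fg.
Qed.

End layer_cake.

(** * The measure of a difference set on the line *)

Section difference_set.
Context {R : realType}.
Local Notation mu := (@lebesgue_measure R).
Local Open Scope ereal_scope.
Implicit Types J S : set (measurableTypeR R).

(** Move the part of [J] above [b] by [- b]. The result lies in [x > 0], its reflection in [x < 0];
    they have equal measure and both consist of differences with [b]. *)
Let difference_set_above J S b : measurable J -> measurable S -> J b ->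
  (forall x y, J x -> J y -> S (x - y)%R) ->
  mu (J `&` `]b, +oo[) <= 2^-1%:E * mu S.
Proof.
move=> mJ mS Jb JS.
set B := J `&` _.
have mB : measurable B by apply: measurableI.
pose A1 := (fun x : measurableTypeR R => (1 * x + b)%R : measurableTypeR R) @^-1` B.
have mA1 : measurable A1.
  by rewrite -[X in measurable X]setTI; exact: measurable_affine.
have mN : measurable_fun setT (-%R : measurableTypeR R -> measurableTypeR R).
  exact: oppr_measurable.
pose A2 := (-%R : measurableTypeR R -> measurableTypeR R) @^-1` A1.
have mA2 : measurable A2.
  by rewrite -[X in measurable X]setTI; exact: mN.
have muA1 : mu A1 = mu B by rewrite [RHS](@lebesgue_measure_affine _ 1 b)// mul1e.
have muA2 : mu A2 = mu B by rewrite -muA1; exact: lebesgue_measureN.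
have : mu B + mu B <= mu S.
  rewrite -[X in X + _]muA1 -muA2 -measureU//.
    apply: le_measure; rewrite ?inE//; first exact: measurableU.
    move=> x [|]; rewrite /A2/A1/= mul1r => -[Jx _].
      by rewrite (_ : x = x + b - b)%R; [exact: JS|ring].
    by rewrite (_ : x = b - (- x + b))%R; [exact: JS|ring].
  apply/seteqP; split=> // x [] [_]/= h1 [_]/=.
  by move: h1; rewrite !in_itv/= !andbT; lra.
rewrite lee_pdivlMl//; by rewrite (_ : 2%:E = 1 + 1)// ge0_muleDl// mul1e.
Qed.

(* The one-dimensional Brunn-Minkowski inequality for [J] and [- J]: if [b] in
   [J] is close to [inf J], then [J - b] and [b - J] almost lie on both sides of [0]. *)
Lemma measure_difference_set J S : measurable J -> measurable S ->
  (forall x y, J x -> J y -> S (x - y)%R) -> mu J <= 2^-1%:E * mu S.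
Proof.
move=> mJ mS JS.
(* The sequence [c] decreases to the infimum of [J], possibly [-oo]. The null set [{a}] absorbs an
   attained infimum, which no []c n, +oo[] contains. *)
have main (a : R) (c : nat -> R) : {homo c : p q / (p <= q)%N >-> (q <= p)%R} ->
    J `<=` (\bigcup_n `]c n, +oo[%classic) `|` [set a] ->
    (forall n, exists2 b, J b & (b <= c n)%R) -> mu J <= 2^-1%:E * mu S.
  move=> ndc Jc cJ.
  have mJc n : measurable (J `&` `]c n, +oo[%classic) by apply: measurableI.
  have mU : measurable (\bigcup_n (J `&` `]c n, +oo[%classic)) by exact: bigcup_measurable.
  have -> : mu J = mu (\bigcup_n (J `&` `]c n, +oo[%classic)).
    apply/eqP; rewrite eq_le; apply/andP; split; last first.
      by apply: le_measure; rewrite ?inE// => x [n _ []].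
    rewrite -[leRHS]adde0 -(lebesgue_measure_set1 a).
    apply: le_trans (measureU2 _ _ _) => //.
    apply: le_measure; rewrite ?inE//; first exact: measurableU.
    by move=> x Jx; have [[n _ xn]|->] := Jc _ Jx; [left; exists n|right].
  have ndJ : nondecreasing_seq (fun n => J `&` `]c n, +oo[%classic).
    move=> p q pq; apply/subsetPset => x [Jx]; rewrite /= in_itv/= andbT => cx.
    by split=> //; rewrite /= in_itv/= andbT; exact: le_lt_trans (ndc _ _ pq) cx.
  have cv := @nondecreasing_cvg_mu _ _ _ mu _ mJc mU ndJ.
  rewrite -(cvg_lim _ cv)//; apply: lime_le; first by apply/cvg_ex; eexists; exact: cv.
  apply: nearW => n /=; have [b Jb bc] := cJ n.
  apply: le_trans (difference_set_above mJ mS Jb JS).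
  apply: le_measure; rewrite ?inE//; first by apply: measurableI.
  by apply: setIS; apply: subset_itvr; rewrite bnd_simp.
have [->|/set0P[x0 Jx0]] := eqVneq J set0.
  by rewrite measure0 mule_ge0// lee_fin.
have [lJ|nlJ] := pselect (has_lbound J).
  have iJ : has_inf J by split=> //; exists x0.
  apply: (main (inf J) (fun n => inf J + n.+1%:R^-1)%R).
  - by move=> p q pq; rewrite lerD2l lef_pV2 ?posrE// ler_nat.
  - move=> x Jx; have : (inf J <= x)%R by exact: inf_lbound.
    rewrite le_eqVlt => /predU1P[->|ltx]; [by right|left].
    have [n _ nx] := near_infty_natSinv_lt (PosNum (etrans (subr_gt0 _ _) ltx)).
    exists n => //=; rewrite in_itv/= andbT; have /= := nx n (leqnn _); set e := (_^-1)%R; lra.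
  - move=> n; have [b Jb bi] := inf_adherent (etrans (invr_gt0 n.+1%:R) (ltr0Sn R n)) iJ.
    by exists b => //; exact: ltW.
apply: (main 0%R (fun n => - n%:R)%R).
- by move=> p q pq; rewrite lerN2 ler_nat.
- move=> x Jx; left; exists (Num.bound `|x|%R) => //=; rewrite in_itv/= andbT.
  have := archi_boundP (normr_ge0 x); have := ler_norm (- x)%R; rewrite normrN.
  by set b := (_ %:R)%R; lra.
- move=> n; apply: contra_notP nlJ => /forall2NP h; exists (- n%:R)%R => x Jx.
  by have [|/negP] := h x => //; rewrite -ltNge => /ltW.
Qed.

End difference_set.

Section tonelli.
Context d1 d2 (T1 : measurableType d1) (T2 : measurableType d2) {R : realType}.
Variables (m1 : {sigma_finite_measure set T1 -> \bar R})
  (m2 : {sigma_finite_measure set T2 -> \bar R}).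
Local Open Scope ereal_scope.

Lemma measurable_integral (f : T1 -> T2 -> \bar R) :
  measurable_fun setT (fun p => f p.1 p.2) -> (forall x y, 0 <= f x y) ->
  measurable_fun setT (fun x => \int[m2]_y f x y).
Proof.
move=> mf f0.
exact: (@measurable_fun_fubini_tonelli_F _ _ _ _ _ m2 (fun p => f p.1 p.2) mf (fun p => f0 p.1 p.2)).
Qed.

Lemma tonelli (f : T1 -> T2 -> \bar R) :
  measurable_fun setT (fun p => f p.1 p.2) -> (forall x y, 0 <= f x y) ->
  \int[m1]_x \int[m2]_y f x y = \int[m2]_y \int[m1]_x f x y.
Proof.
move=> mf f0.
exact: (@fubini_tonelli _ _ _ _ _ m1 m2 (fun p => f p.1 p.2) mf (fun p => f0 p.1 p.2)).
Qed.

End tonelli.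

(** * The midpoint Prekopa-Leindler inequality on the line *)

Section prekopa.
Context {R : realType}.
Local Notation mu := (@lebesgue_measure R).
Local Open Scope ereal_scope.
Implicit Types f g a b h : measurableTypeR R -> \bar R.

Lemma integral_convolution f g :
  measurable_fun setT f -> (forall x, 0 <= f x) ->
  measurable_fun setT g -> (forall x, 0 <= g x) ->
  \int[mu]_t \int[mu]_s (f s * g (t - s)%R) = \int[mu]_x f x * \int[mu]_x g x.
Proof.
move=> mf f0 mg g0.
rewrite tonelli//=; last 2 first.
- apply: emeasurable_funM; first exact: measurableT_comp.
  by apply: measurableT_comp => //; exact: measurable_funB.
- by move=> x y; rewrite mule_ge0.
under eq_integral => s _.
  rewrite ge0_integralZl//; last first.
    by apply: measurableT_comp => //; exact: measurable_funB.
  rewrite (integral_shift (- s) mg g0).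
  over.
by rewrite ge0_integralZr// integral_ge0.
Qed.

Lemma lt_sqr_ereal (r : R) (u v w : \bar R) : (0 < r)%R -> 0 <= w ->
  r%:E < u -> r%:E < v -> u * v <= w * w -> r%:E < w.
Proof.
move=> r0 w0 ru rv uvw; rewrite ltNge; apply/negP => wr.
have : w * w <= r%:E * r%:E by apply: lee_pmul.
move=> /(le_trans uvw); apply/negP; rewrite -ltNge.
apply: (@lt_le_trans _ _ (r%:E * v)).
  by rewrite lte_pmul2l// lte_fin.
by rewrite lee_wpmul2r ?ltW// (lt_trans _ rv)// lte_fin.
Qed.

(* The midpoint Prekopa-Leindler inequality. It is proved in the stronger form
   [a * b <= h * h] for convolutions, pointwise: if [J] is a superlevel set of
   [s |-> a s * b (t - s)], then the same superlevel set of
   [s |-> h s * h (t - s)] contains [(t + J - J) / 2]. *)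
Lemma prekopa_leindler a b h :
  measurable_fun setT a -> (forall x, 0 <= a x) ->
  measurable_fun setT b -> (forall x, 0 <= b x) ->
  measurable_fun setT h -> (forall x, 0 <= h x) ->
  (forall s t, a s * b t <= h (2^-1 * (s + t))%R * h (2^-1 * (s + t))%R) ->
  \int[mu]_x a x * \int[mu]_x b x <= \int[mu]_x h x * \int[mu]_x h x.
Proof.
move=> ma a0 mb b0 mh h0 abh.
have m_sub t : measurable_fun setT (fun s : measurableTypeR R => (t - s)%R : measurableTypeR R).
  exact: measurable_funB.
have mconv (f g : measurableTypeR R -> \bar R) t : measurable_fun setT f -> measurable_fun setT g ->
    measurable_fun setT (fun s => f s * g (t - s)%R).
  move=> mf mg; apply: emeasurable_funM => //.
  exact: (measurableT_comp mg).
have mconv2 (f g : measurableTypeR R -> \bar R) : measurable_fun setT f -> measurable_fun setT g ->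
    (forall x, 0 <= f x) -> (forall x, 0 <= g x) ->
    measurable_fun setT (fun t : measurableTypeR R => \int[mu]_s (f s * g (t - s)%R)).
  move=> mf mg f0 g0.
  apply: (measurable_integral mu (f := fun t s : measurableTypeR R => f s * g (t - s)%R)) => /=.
    apply: emeasurable_funM; first exact: measurableT_comp.
    by apply: measurableT_comp => //; exact: measurable_funB.
  by move=> x y; rewrite mule_ge0.
rewrite -!integral_convolution//; apply: ge0_le_integral => //.
- by move=> t _; apply: integral_ge0 => s _; rewrite mule_ge0.
- exact: mconv2.
- exact: mconv2.
move=> t _; apply: le_integral_level => //.
- exact: mconv.
- by move=> s; rewrite mule_ge0.
- exact: mconv.
- by move=> s; rewrite mule_ge0.
move=> r r0; set J := [set x | _]; set H := [set x | _].
have mJ : measurable J by apply: measurable_level; exact: mconv.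
have mH : measurable H by apply: measurable_level; exact: mconv.
(* The slope [1/2] of [phi] produces the factor [1/2] of [measure_difference_set], so it is enough
   that [phi] maps [J - J] into [H]. *)
pose phi (x : measurableTypeR R) := (2^-1 * x + 2^-1 * t)%R : measurableTypeR R.
suff : mu J <= mu H by [].
rewrite (@lebesgue_measure_affine _ 2^-1 (2^-1 * t) H)//.
apply: (measure_difference_set (S := phi @^-1` H)) => //.
  by rewrite -[X in measurable X]setTI; exact: measurable_affine.
move=> x y Jx Jy; rewrite /H/= /phi.
apply: (lt_sqr_ereal r0 _ Jx Jy); first by rewrite mule_ge0.
(* The two arguments of [h] are the midpoints of [x, t - y] and of [y, t - x]. Regrouping the four
   factors crosswise lets [abh] apply to each pair. *)
rewrite (_ : 2^-1 * (x - y) + 2^-1 * t = 2^-1 * (x + (t - y)))%R; last by ring.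
rewrite (_ : t - 2^-1 * (x + (t - y)) = 2^-1 * (y + (t - x)))%R; last by field.
rewrite [leRHS]muleACA [leLHS]muleACA (muleC (b _)) [leLHS]muleACA.
by  apply: lee_pmul; rewrite ?mule_ge0 ?abh.
Qed.

End prekopa.

(** * Lebesgue measure on R^n and linear maps *)

Section measurable_sets.
Context {R : realType} d (T : measurableType d).

Lemma measurable_ler_set (f g : T -> R) :
  measurable_fun setT f -> measurable_fun setT g -> measurable [set x | (f x <= g x)%R].
Proof.
move=> mf mg; rewrite -[X in measurable X]setTI.
apply: (@measurable_lee _ _ R _ measurableT (EFin \o f) (EFin \o g)); exact/measurable_EFinP.
Qed.

Lemma measurable_ltr_set (f g : T -> R) :
  measurable_fun setT f -> measurable_fun setT g -> measurable [set x | (f x < g x)%R].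
Proof.
move=> mf mg; rewrite -[X in measurable X]setTI.
apply: (@measurable_lte _ _ R _ measurableT (EFin \o f) (EFin \o g)); exact/measurable_EFinP.
Qed.

Lemma measurable_forall (I : finType) (F : I -> set T) :
  (forall i, measurable (F i)) -> measurable [set x | forall i, F i x].
Proof.
move=> mF; rewrite (_ : [set x | _] = \bigcap_(i in [set: I]) F i).
  by apply: fin_bigcap_measurable => // i _.
by apply/seteqP; split=> [x h i _|x h i]; [exact: h|exact: (h i)].
Qed.

End measurable_sets.

Section measurable_linear.
Context {R : realType} d (T : measurableType d).

Lemma measurable_rV_mulmx m n (A : 'M[R]_(m, n)) :
  measurable_fun setT (fun x : 'rV[R]_m => x *m A).
Proof.
apply/measurable_fun_rVP => j; under eq_fun do rewrite mxE.
by apply: measurable_sum => i; apply: measurable_funM => //; exact: measurable_coord.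
Qed.

Lemma measurable_rVD n (f g : T -> 'rV[R]_n) : measurable_fun setT f -> measurable_fun setT g ->
  measurable_fun setT (fun x => f x + g x).
Proof.
move=> mf mg; apply/measurable_fun_rVP => j; under eq_fun do rewrite mxE.
by apply: measurable_funD; exact: (measurableT_comp (measurable_coord j)).
Qed.

Lemma measurable_rVZ n (c : R) (f : T -> 'rV[R]_n) : measurable_fun setT f ->
  measurable_fun setT (fun x => c *: f x).
Proof.
move=> mf; apply/measurable_fun_rVP => j; under eq_fun do rewrite mxE.
by apply: measurable_funM => //; exact: (measurableT_comp (measurable_coord j)).
Qed.

Lemma measurable_rVN n (f : T -> 'rV[R]_n) : measurable_fun setT f ->
  measurable_fun setT (fun x => - f x).
Proof.
by move=> mf; under eq_fun do rewrite -scaleN1r; exact: measurable_rVZ.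
Qed.

Lemma measurable_rVB n (f g : T -> 'rV[R]_n) : measurable_fun setT f -> measurable_fun setT g ->
  measurable_fun setT (fun x => f x - g x).
Proof. by move=> mf mg; apply: measurable_rVD => //; exact: measurable_rVN. Qed.

Lemma measurable_dotr n (c : 'rV[R]_n) : measurable_fun setT (dotr c).
Proof.
by apply: measurable_sum => i; apply: measurable_funM => //; exact: measurable_coord.
Qed.

End measurable_linear.

(** * Translations, reflections and invertible linear changes of variables *)

Section lebesgue_rV_linear.
Context {R : realType}.
Local Notation mu := (@lebesgue_measure R).
Local Open Scope ereal_scope.

Lemma integral_rVS n (f : 'rV[R]_n.+1 -> \bar R) :
  measurable_fun setT f -> (forall x, 0 <= f x) ->
  \int[lebesgue_rV n.+1]_z f z = \int[mu]_s \int[lebesgue_rV n]_x f (rV_cons (s, x)).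
Proof.
move=> mf f0.
rewrite [LHS](ge0_integral_pushforward (@measurable_rV_cons R n) _ measurableT)//.
rewrite preimage_setT fubini_tonelli1//.
  exact: (measurableT_comp mf (@measurable_rV_cons R n)).
by move=> p /=.
Qed.

Lemma rV_consD n (s t : R) (x y : 'rV[R]_n) :
  (rV_cons (s, x) + rV_cons (t, y) = rV_cons (s + t, x + y) :> 'rV[R]_n.+1)%R.
Proof.
by apply/rowP => i; case: (unliftP ord0 i) => [j|] ->; rewrite mxE ?rV_consS ?rV_cons0//= mxE.
Qed.

Lemma rV_consZ n (c s : R) (x : 'rV[R]_n) :
  (c *: rV_cons (s, x) = rV_cons (c * s, c *: x) :> 'rV[R]_n.+1)%R.
Proof.
by apply/rowP => i; case: (unliftP ord0 i) => [j|] ->; rewrite mxE ?rV_consS ?rV_cons0//= mxE.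
Qed.

Lemma measurable_rV_cons2 n (s : R) : measurable_fun setT (fun x : 'rV[R]_n => rV_cons (s, x)).
Proof.
apply: (measurableT_comp (@measurable_rV_cons R n)); exact: measurable_fun_pair.
Qed.

Lemma integral_rV_shift n (b : 'rV[R]_n) (f : 'rV[R]_n -> \bar R) :
  measurable_fun setT f -> (forall x, 0 <= f x) ->
  \int[lebesgue_rV n]_x f (x + b)%R = \int[lebesgue_rV n]_x f x.
Proof.
elim: n b f => [|n IH] b f mf f0.
  by apply: eq_integral => x _; congr f; rewrite [LHS]thinmx0 [RHS]thinmx0.
have mfb : measurable_fun setT (fun x : 'rV[R]_n.+1 => f (x + b)%R).
  apply: measurableT_comp => //; exact: measurable_rVD.
rewrite (integral_rVS mfb (fun=> f0 _)) (integral_rVS mf f0).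
rewrite -[b]rV_unconsK; case: (rV_uncons b) => t y.
under eq_integral => s _.
  under eq_integral do rewrite rV_consD.
  rewrite (IH y (fun x => f (rV_cons ((s + t)%R, x))))//; last first.
    by apply: measurableT_comp => //; exact: measurable_rV_cons2.
  over.
rewrite (integral_shift t (f := fun s => \int[lebesgue_rV n]_x f (rV_cons (s, x))))//.
  apply: measurable_integral => //.
  exact: (measurableT_comp mf (@measurable_rV_cons R n)).
by move=> s; exact: integral_ge0.
Qed.

Definition unit_box n : set 'rV[R]_n := [set x | forall i, `[0%R, 1%R]%classic (x ord0 i)].

Arguments unit_box n x : clear implicits.

Lemma measurable_unit_box n : measurable (unit_box n).
Proof. by apply: (measurable_rV_box (B := fun=> `[0%R, 1%R]%classic)) => i. Qed.

Lemma lebesgue_rV_unit_box n : lebesgue_rV n (unit_box n) = 1.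
Proof.
rewrite (@lebesgue_rV_box _ _ (fun=> `[0%R, 1%R]%classic))//.
by rewrite big1// => i _; rewrite lebesgue_measure_itv/= lte_fin ltr01 oppr0 adde0.
Qed.

Lemma indic_unit_box_ge0 n (x : 'rV[R]_n) : 0 <= (\1_(unit_box n) x : R)%:E.
Proof. by rewrite lee_fin. Qed.

Lemma integral_unit_box n : \int[lebesgue_rV n]_x (\1_(unit_box n) x)%:E = 1.
Proof.
have mB := @measurable_unit_box n.
by rewrite integral_indic// setIT; exact: lebesgue_rV_unit_box.
Qed.

(* Tonelli applied to [phi (x A) * psi (z + x A)]. *)
Let haar_exchange k n (A : 'M[R]_(k, n)) (B : 'M[R]_(n, k)) (phi psi : 'rV[R]_n -> \bar R) :
  B *m A = 1%:M ->
  measurable_fun setT phi -> (forall x, 0 <= phi x) ->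
  measurable_fun setT psi -> (forall x, 0 <= psi x) ->
  \int[lebesgue_rV k]_x phi (x *m A) * \int[lebesgue_rV n]_z psi z =
  \int[lebesgue_rV n]_z phi (- z)%R * \int[lebesgue_rV k]_x psi (x *m A).
Proof.
move=> BA mphi phi0 mpsi psi0.
have mA := measurable_rV_mulmx A.
have mphiA : measurable_fun setT (fun x : 'rV[R]_k => phi (x *m A)) by exact: measurableT_comp.
have mpsiA : measurable_fun setT (fun x : 'rV[R]_k => psi (x *m A)) by exact: measurableT_comp.
have mphiN : measurable_fun setT (fun x : 'rV[R]_n => phi (- x)%R).
  by apply: measurableT_comp => //; exact: measurable_rVN.
transitivity (\int[lebesgue_rV k]_x \int[lebesgue_rV n]_z (phi (x *m A) * psi (z + x *m A)%R)).
  rewrite -ge0_integralZr ?integral_ge0//; apply: eq_integral => x _.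
  rewrite ge0_integralZl//; first by rewrite integral_rV_shift.
  by apply: measurableT_comp => //; exact: measurable_rVD.
transitivity (\int[lebesgue_rV n]_z \int[lebesgue_rV k]_x (phi (x *m A - z)%R * psi (x *m A))).
  pose F (x : 'rV[R]_k) (z : 'rV[R]_n) := phi (x *m A) * psi (z + x *m A)%R.
  have mF : measurable_fun setT (fun p : 'rV[R]_k * 'rV[R]_n => F p.1 p.2).
    rewrite /F; apply: emeasurable_funM; first by apply: (measurableT_comp mphiA).
    apply: (measurableT_comp mpsi); apply: measurable_rVD => //.
    exact: (measurableT_comp mA).
  have F0 x z : 0 <= F x z by rewrite mule_ge0.
  rewrite (tonelli (lebesgue_rV k) (lebesgue_rV n) mF F0) /F; apply: eq_integral => z _.
  (* Since [B *m A = 1], shifting [x] by [- z B] shifts [x A] by [- z], which moves [z] from the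
     argument of [psi] to that of [phi]. *)
  rewrite -[LHS](integral_rV_shift (- (z *m B))%R)//; last 2 first.
  - apply: emeasurable_funM => //.
    by apply: measurableT_comp => //; exact: measurable_rVD.
  - by move=> x; rewrite mule_ge0.
  apply: eq_integral => x _; rewrite mulmxDl mulNmx -mulmxA BA mulmx1.
  by rewrite (addrC z) subrK.
pose G (x : 'rV[R]_k) (z : 'rV[R]_n) := phi (x *m A - z)%R * psi (x *m A).
have mG : measurable_fun setT (fun p : 'rV[R]_k * 'rV[R]_n => G p.1 p.2).
  rewrite /G; apply: emeasurable_funM; last by apply: (measurableT_comp mpsiA).
  apply: (measurableT_comp mphi); apply: measurable_rVB => //.
  exact: (measurableT_comp mA).
have G0 x z : 0 <= G x z by rewrite mule_ge0.
rewrite -(tonelli (lebesgue_rV k) (lebesgue_rV n) mG G0) /G.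
rewrite -ge0_integralZl ?integral_ge0//; apply: eq_integral => x _.
rewrite ge0_integralZr//; last first.
  by apply: measurableT_comp => //; apply: measurable_rVB.
congr (_ * _); rewrite -[RHS](integral_rV_shift (- (x *m A))%R)//.
by apply: eq_integral => z _; rewrite opprB.
Qed.

(** The exchange identity for the identity matrix, with the indicator of the unit box as [psi]: both
    integrals of [psi] are [1]. *)
Lemma integral_rV_opp n (f : 'rV[R]_n -> \bar R) :
  measurable_fun setT f -> (forall x, 0 <= f x) ->
  \int[lebesgue_rV n]_x f (- x)%R = \int[lebesgue_rV n]_x f x.
Proof.
move=> mf f0; have m1 : measurable_fun setT (EFin \o \1_(unit_box n) : 'rV[R]_n -> \bar R).
  by apply/measurable_EFinP/measurable_indic; exact: measurable_unit_box.
have := @haar_exchange n n 1%:M 1%:M f (EFin \o \1_(unit_box n)) (mulmx1 _) mf f0 m1 (@indic_unit_box_ge0 n).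
have E (g : 'rV[R]_n -> \bar R) :
    \int[lebesgue_rV n]_x g (x *m 1%:M) = \int[lebesgue_rV n]_x g x.
  by apply: eq_integral => x _; rewrite mulmx1.
by rewrite !E integral_unit_box !mule1.

Qed.

(* By uniqueness of Haar measure; [c] is [`|\det A|^-1]. *)
Lemma integral_linear_change k n (A : 'M[R]_(k, n)) (B : 'M[R]_(n, k)) :
  A *m B = 1%:M -> B *m A = 1%:M ->
  exists2 c : R, (0 < c)%R & forall f : 'rV[R]_n -> \bar R,
    measurable_fun setT f -> (forall x, 0 <= f x) ->
    \int[lebesgue_rV k]_x f (x *m A) = c%:E * \int[lebesgue_rV n]_z f z.
Proof.
move=> AB BA.
have m1 j : measurable_fun setT (EFin \o \1_(unit_box j) : 'rV[R]_j -> \bar R).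
  by apply/measurable_EFinP/measurable_indic; exact: measurable_unit_box.
pose C := \int[lebesgue_rV k]_x (\1_(unit_box n) (x *m A))%:E.
have C0 : 0 <= C by apply: integral_ge0 => x _; rewrite lee_fin.
have main (f : 'rV[R]_n -> \bar R) : measurable_fun setT f -> (forall x, 0 <= f x) ->
    \int[lebesgue_rV k]_x f (x *m A) = C * \int[lebesgue_rV n]_z f z.
  move=> mf f0; have := haar_exchange BA mf f0 (m1 n) (@indic_unit_box_ge0 n).
  by rewrite integral_rV_opp//= integral_unit_box mule1 muleC.
(* Testing [main] on the image of the unit box of the source space writes [1] as a multiple of [C],
   which excludes both [C = 0] and [C = +oo]. *)
have : 1 = C * \int[lebesgue_rV n]_z (\1_(unit_box k) (z *m B))%:E.
  rewrite -(main (fun z => (\1_(unit_box k) (z *m B))%:E)).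
  - by under eq_integral do rewrite -mulmxA AB mulmx1; rewrite integral_unit_box.
  - exact: (measurableT_comp (m1 k) (measurable_rV_mulmx B)).
  - by move=> z; rewrite lee_fin.
set D := \int[_]_z _; have D0 : 0 <= D by apply: integral_ge0 => x _; rewrite lee_fin.
case: C C0 main => [c| |]// C0 main.
  move=> h; exists c => //; rewrite lt_neqAle -lee_fin C0 andbT; apply/eqP => c0.
  by move: h; rewrite -c0 mul0e => /eqP; rewrite onee_eq0.
move: D0; rewrite le_eqVlt => /predU1P[<-|D0].
  by rewrite mule0 => /eqP; rewrite onee_eq0.
by rewrite gt0_mulye.
Qed.

End lebesgue_rV_linear.

(** * Log-concave functions and their marginals *)

(** The squared midpoint form makes sense for infinite values without real powers, and it is what
    [prekopa_leindler] preserves. *)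
Definition midpoint_log_concave {R : realType} {V : lmodType R} (f : V -> \bar R) :=
  forall x y, (f x * f y <= f (2^-1 *: (x + y))%R * f (2^-1 *: (x + y))%R)%E.

Section midpoint_log_concave.
Context {R : realType} {V : lmodType R}.
Variable g : V -> \bar R.
Hypotheses (g0 : forall x, (0 <= g x)%E) (gm : midpoint_log_concave g).
Local Open Scope ereal_scope.

Let halfDD (x : V) : (2^-1 *: (x + x) = x)%R.
Proof. by rewrite scalerDr -scalerDl (_ : 2^-1 + 2^-1 = 1)%R ?scale1r//; field. Qed.

Let midpoint_infty x m q : 0 < g x -> g m = +oo ->
  g (x + 2^-1 ^+ q *: (m - x))%R = +oo.
Proof.
move=> gx goo; elim: q => [|q IH]; first by rewrite expr0 scale1r addrC subrK.
have := gm x (x + 2^-1 ^+ q *: (m - x))%R; rewrite IH gt0_muley//.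
rewrite [X in g X](_ : _ = (x + 2^-1 ^+ q.+1 *: (m - x))%R).
  case: (g _) (g0 (x + 2^-1 ^+ q.+1 *: (m - x))%R) => [r| |]//.
by rewrite addrA scalerDr halfDD scalerA -exprS.
Qed.

(** Induction on [q] by bisection at the midpoint [m]. With [d] the new step, multiply the bounds
    for [[x, m]] and [[m, y]], use [g (m - d) * g (m + d) <= g m * g m], and cancel the square of
    [g m]. Cancelling needs [g m] finite; otherwise [midpoint_infty] makes the right-hand side
    infinite. *)
Lemma midpoint_log_concave_dyadic q x y :
  g x * g y <= g (x + 2^-1 ^+ q *: (y - x))%R * g (y - 2^-1 ^+ q *: (y - x))%R.
Proof.
elim: q x y => [|q IH] x y.
  by rewrite expr0 scale1r addrC subrK subKr muleC.
have [->|gx] := eqVneq (g x) 0; first by rewrite mul0e mule_ge0.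
have [->|gy] := eqVneq (g y) 0; first by rewrite mule0 mule_ge0.
have {}gx : 0 < g x by rewrite lt_neqAle eq_sym gx g0.
have {}gy : 0 < g y by rewrite lt_neqAle eq_sym gy g0.
pose m := (2^-1 *: (x + y))%R.
have gmm := gm x y; rewrite -/m in gmm.
have mx : (m - x = 2^-1 *: (y - x))%R.
  by rewrite -[X in (_ - X)%R]halfDD -scalerBr opprD addrACA subrr add0r.
have my : (m - y = 2^-1 *: (x - y))%R.
  by rewrite -[X in (_ - X)%R]halfDD -scalerBr opprD addrACA subrr addr0.
have xm : (2^-1 ^+ q.+1 *: (y - x) = 2^-1 ^+ q *: (m - x))%R.
  by rewrite mx scalerA -exprSr.
have ym : (2^-1 ^+ q.+1 *: (y - x) = - (2^-1 ^+ q *: (m - y)))%R.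
  by rewrite my scalerA -exprSr -scalerN opprB.
have gm0 : g m != 0.
  by apply: contraTneq gmm => ->; rewrite mule0 -ltNge mule_gt0.
have : 0 <= g m by [].
case E : (g m) => [c| |]// c0; last first.
  by rewrite {1}xm ym opprK !midpoint_infty// leey.
have {}c0 : (0 < c)%R by rewrite lt_neqAle -lee_fin c0 andbT eq_sym -eqe -E.
have h1 := IH x m; have h2 := IH m y.
rewrite -xm in h1.
have {}my : (2^-1 ^+ q *: (y - m) = 2^-1 ^+ q.+1 *: (y - x))%R.
  by rewrite ym -(opprB m y) scalerN.
rewrite my in h2.
set d := (2^-1 ^+ q.+1 *: (y - x))%R in h1 h2 *.
have h3 := gm (m - d)%R (m + d)%R.
have mdd : (2^-1 *: (m - d + (m + d)) = m)%R by rewrite addrACA addNr addr0 halfDD.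
rewrite mdd in h3; rewrite E in h1 h2 h3.
rewrite -(@lee_pmul2r _ (c * c)%:E)// ?lte_fin ?mulr_gt0//.
rewrite EFinM muleACA (muleC (g y)).
have c1 := ltW c0.
apply: le_trans (lee_pmul _ _ h1 h2) _; rewrite ?mule_ge0// ?lee_fin//.
rewrite (muleC (g (m + d)%R)) muleACA.
by apply: lee_pmul => //; rewrite mule_ge0.
Qed.

End midpoint_log_concave.

Section rV_scale.
Context {R : realType}.
Local Open Scope ereal_scope.

Lemma integral_rV_scale n (s : R) (f : 'rV[R]_n -> \bar R) : (0 < s)%R ->
  measurable_fun setT f -> (forall x, 0 <= f x) ->
  \int[lebesgue_rV n]_x f x = (s ^+ n)%:E * \int[lebesgue_rV n]_x f (s *: x)%R.
Proof.
move=> s0; elim: n f => [|n IH] f mf f0.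
  rewrite mul1e; apply: eq_integral => x _; congr f.
  by rewrite [LHS]thinmx0 [RHS]thinmx0.
have mfs : measurable_fun setT (fun x : 'rV[R]_n.+1 => f (s *: x)%R).
  by apply: measurableT_comp => //; exact: measurable_rVZ.
have mcons (t : R) : measurable_fun setT (fun x : 'rV[R]_n => f (rV_cons (t, x))).
  by apply: measurableT_comp => //; exact: measurable_rV_cons2.
have mf2 : measurable_fun setT (fun t : measurableTypeR R => \int[lebesgue_rV n]_x f (rV_cons (t, x))).
  by apply: measurable_integral => //; exact: (measurableT_comp mf (@measurable_rV_cons R n)).
rewrite (integral_rVS mf f0) (integral_rVS mfs (fun=> f0 _)).
rewrite (integral_affine 0 s0 mf2 (fun=> integral_ge0 _ (fun x _ => f0 _))).
rewrite exprS EFinM -muleA; congr (_ * _).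
rewrite -ge0_integralZl//; last 3 first.
- apply: (measurable_integral (lebesgue_rV n) (f := fun (t : measurableTypeR R) (x : 'rV[R]_n) => f (s *: rV_cons (t, x))%R)) => //.
  exact: (measurableT_comp mfs (@measurable_rV_cons R n)).
- by move=> t _; exact: integral_ge0.
- by rewrite lee_fin exprn_ge0// ltW.
apply: eq_integral => t _; rewrite addr0 IH//; congr (_ * _).
by apply: eq_integral => x _; rewrite rV_consZ.
Qed.

End rV_scale.

(** * Marginals of functions on [R^(k + n)] *)

Section marginal.
Context {R : realType}.
Local Notation mu := (@lebesgue_measure R).
Local Open Scope ereal_scope.

(** The first [k] coordinates are integrated out one at a time, so that one-dimensional Tonelli and
    Prekopa-Leindler suffice at each step. *)
Fixpoint marginal k n : ('rV[R]_(k + n) -> \bar R) -> 'rV[R]_n -> \bar R :=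
  match k with
  | 0 => id
  | k'.+1 => fun f => @marginal k' n (fun z => \int[mu]_s f (rV_cons (s, z)))
  end.

Let step_ge0 n (f : 'rV[R]_n.+1 -> \bar R) : (forall z, 0 <= f z) ->
  forall z, 0 <= \int[mu]_s f (rV_cons (s, z)).
Proof. by move=> f0 z; exact: integral_ge0. Qed.

Let measurable_step n (f : 'rV[R]_n.+1 -> \bar R) : measurable_fun setT f ->
  (forall z, 0 <= f z) -> measurable_fun setT (fun z => \int[mu]_s f (rV_cons (s, z))).
Proof.
move=> mf f0; apply: (measurable_integral mu (f := fun (z : 'rV[R]_n) (s : measurableTypeR R) => f (rV_cons (s, z)))) => //.
have : measurable_fun setT (f \o (@rV_cons R n)).
  exact: (measurableT_comp mf (@measurable_rV_cons R n)).
by move=> /measurableT_comp; apply; exact: measurable_swap.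
Qed.

Lemma marginal_ge0 k n (f : 'rV[R]_(k + n) -> \bar R) : (forall z, 0 <= f z) ->
  forall y, 0 <= marginal f y.
Proof. by elim: k f => [|k IH] f f0 y //=; apply: IH => z; exact: step_ge0. Qed.

Lemma measurable_marginal k n (f : 'rV[R]_(k + n) -> \bar R) : measurable_fun setT f ->
  (forall z, 0 <= f z) -> measurable_fun setT (marginal f).
Proof.
elim: k f => [|k IH] f mf f0 //=.
by apply: IH => [|z]; [exact: measurable_step|exact: step_ge0].
Qed.

Lemma integral_marginal k n (f : 'rV[R]_(k + n) -> \bar R) : measurable_fun setT f ->
  (forall z, 0 <= f z) ->
  \int[lebesgue_rV n]_y marginal f y = \int[lebesgue_rV (k + n)]_z f z.
Proof.
elim: k f => [|k IH] f mf f0 //=.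
rewrite IH//; [|exact: measurable_step|by move=> z; exact: step_ge0].
rewrite [RHS](@integral_rVS _ (k + n) f)// [RHS]tonelli//.
exact: (measurableT_comp mf (@measurable_rV_cons R (k + n))).
Qed.

Lemma rsubmx_rV_cons k n (s : R) (z : 'rV[R]_(k + n)) :
  @rsubmx R 1 k.+1 n (rV_cons (s, z)) = rsubmx z.
Proof.
apply/rowP => i; rewrite [LHS]mxE [RHS]mxE -(rV_consS (s, z)); congr (rV_cons _ _ _).
exact: val_inj.
Qed.

Lemma marginalZr k n (f : 'rV[R]_(k + n) -> \bar R) (chi : 'rV[R]_n -> \bar R) y :
  measurable_fun setT f -> (forall z, 0 <= f z) -> (forall y, 0 <= chi y) ->
  marginal (fun z => f z * chi (rsubmx z)) y = marginal f y * chi y.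
Proof.
elim: k f => [|k IH] f mf f0 chi0 /=.
  congr (_ * chi _); apply/rowP => i; rewrite mxE; congr (y _ _); exact: val_inj.
rewrite -IH//; last 2 first.
- exact: measurable_step.
- by move=> z; exact: step_ge0.
congr (marginal _ y); apply/funext => z.
rewrite -ge0_integralZr//; first by apply: eq_integral => s _; rewrite rsubmx_rV_cons.
apply: (measurableT_comp mf).
by apply: (measurableT_comp (@measurable_rV_cons R (k + n))); exact: measurable_fun_pair.
Qed.

Lemma midpoint_log_concave_marginal k n (f : 'rV[R]_(k + n) -> \bar R) :
  measurable_fun setT f -> (forall z, 0 <= f z) ->
  midpoint_log_concave f -> midpoint_log_concave (marginal f).
Proof.
elim: k f => [|k IH] f mf f0 fm //=; apply: IH.
- exact: measurable_step.
- by move=> z; exact: step_ge0.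
move=> x y.
have ms z : measurable_fun setT (fun s => f (rV_cons (s, z))).
  apply: (measurableT_comp mf).
  by apply: (measurableT_comp (@measurable_rV_cons R (k + n))); exact: measurable_fun_pair.
apply: prekopa_leindler => // s t.
by have := fm (rV_cons (s, x)) (rV_cons (t, y)); rewrite rV_consD rV_consZ.
Qed.

End marginal.

(** * The contraction inequality for log-concave functions *)

Section contraction.
Context {R : realType}.
Local Open Scope ereal_scope.

(** AM-GM for [a * y] and [x * b], whose product is at least [(x * y)^2]. Once all factors are
    positive, an infinite one makes the right-hand side infinite. *)
Lemma amgm_ereal (a b x y : \bar R) : 0 <= a -> 0 <= b -> 0 <= x -> 0 <= y ->
  x * y <= a * b -> x * y + x * y <= a * y + x * b.
Proof.
move=> a0 b0 x0 y0 xyab.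
have [->|xn0] := eqVneq x 0; first by rewrite !mul0e !adde0 mule_ge0.
have [->|yn0] := eqVneq y 0; first by rewrite !mule0 !add0e mule_ge0.
have {}x0 : 0 < x by rewrite lt_neqAle eq_sym xn0.
have {}y0 : 0 < y by rewrite lt_neqAle eq_sym yn0.
have ab0 : 0 < a * b by apply: lt_le_trans xyab; rewrite mule_gt0.
have {}a0 : 0 < a.
  by rewrite lt_neqAle a0 andbT; apply: contraTneq ab0 => <-; rewrite mul0e ltxx.
have {}b0 : 0 < b.
  by rewrite lt_neqAle b0 andbT; apply: contraTneq ab0 => <-; rewrite mule0 ltxx.
have ay0 : 0 <= a * y by rewrite mule_ge0 ?ltW.
have xb0 : 0 <= x * b by rewrite mule_ge0 ?ltW.
case: a b x y a0 b0 x0 y0 ay0 xb0 xyab {ab0 xn0 yn0} => [a| |] [b| |] [x| |] [y| |]// a0 b0 x0 y0 ay0 xb0;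
  rewrite ?[_ * +oo]gt0_muley// ?[+oo * _]gt0_mulye// ?(addye, addey) ?leey//.
rewrite -!EFinM -!EFinD !lee_fin => h.
move: a0 b0 x0 y0; rewrite !lte_fin => a0 b0 x0 y0.
have a1 := ltW a0; have b1 := ltW b0; have x1 := ltW x0; have y1 := ltW y0.
rewrite -(@ler_pXn2r _ 2)// ?nnegrE ?addr_ge0 ?mulr_ge0//.
have : (0 <= (a * y - x * b) ^+ 2)%R by exact: sqr_ge0.
have : (x * y * (x * y) <= a * b * (x * y))%R by rewrite ler_wpM2r// mulr_ge0.
by nra.
Qed.

Lemma lee_of_eq (x y : \bar R) : x = y -> x <= y.
Proof. by move=> ->. Qed.

Lemma lee_double (x y : \bar R) : x + x <= y + y -> x <= y.
Proof. by rewrite !leNgt; apply: contra => yx; exact: lteD. Qed.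

Lemma measurable_indic_comp d d' (T : measurableType d) (U : measurableType d') (Q : set U) (h : T -> U) :
  measurable Q -> measurable_fun setT h -> measurable_fun setT (fun x => (\1_Q (h x) : R)%:E).
Proof.
move=> mQ mh; apply/measurable_EFinP.
by apply: (measurableT_comp (f := \1_Q : U -> R)) => //; exact: measurable_indic.
Qed.

(* For [y], [v] in the support of [g], the two points [y + l (v - y)] and
   [v - l (v - y)] have [g]-values [a], [b] with [g y * g v <= a * b], hence
   [2 g y * g v <= a * g v + g y * b] by AM-GM. Integrating over all pairs
   replaces the subgradient of [ln g] at the centroid. *)
Lemma contraction_support n (g : 'rV[R]_n -> \bar R) (Q : set 'rV[R]_n) (q : nat) (l : R) :
  l = (2^-1 ^+ q.+1)%R ->
  measurable_fun setT g -> (forall y, 0 <= g y) -> midpoint_log_concave g ->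
  measurable Q -> (forall y, g y != 0 -> Q y) ->
  ((1 - l) ^+ n)%:E * (\int[lebesgue_rV n]_y g y * \int[lebesgue_rV n]_y g y) <=
  \int[lebesgue_rV n]_v \int[lebesgue_rV n]_u
    (g v * (g u * (\1_Q ((1 - l)^-1 *: (u - l *: v)))%:E)).
Proof.
move=> lE mg g0 gm mQ gQ; set s := (1 - l)%R.
have s0 : (0 < s)%R by rewrite subr_gt0 lE exprn_ilt1// ?invr_ge0// invf_lt1// ltr1n.
have one0 y : 0 <= (\1_Q y : R)%:E by rewrite lee_fin.
pose V : measurableType _ := 'rV[R]_n.
have mlin (c d : R) : measurable_fun setT (fun p : V * V => (c *: p.1 + d *: p.2)%R : V).
  by apply: measurable_rVD; apply: measurable_rVZ.
have mglin (c d : R) : measurable_fun setT (fun p : V * V => g (c *: p.1 + d *: p.2)%R).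
  by apply: measurableT_comp.
have conv (y v : 'rV[R]_n) : (y + l *: (v - y) = l *: v + s *: y)%R.
  by rewrite /s scalerBl scale1r scalerBr addrCA.
(* The indicator records that [y] lies in the support; after [y] is eliminated below it becomes the
   condition on [u - l v]. *)
pose h v y := g v * (g (y + l *: (v - y))%R * (\1_Q y)%:E).
have h0 v y : 0 <= h v y by rewrite !mule_ge0.
have mh : measurable_fun setT (fun p => h p.1 p.2).
  apply: emeasurable_funM; first exact: measurableT_comp.
  apply: emeasurable_funM; last exact: measurable_indic_comp.
  by under eq_fun do rewrite conv; exact: mglin.
have mh' : measurable_fun setT (fun p : V * V => h p.2 p.1).
  exact: (measurableT_comp mh (@measurable_swap _ _ V V)).
have X2 : \int[lebesgue_rV n]_y g y * \int[lebesgue_rV n]_y g y <=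
    \int[lebesgue_rV n]_v \int[lebesgue_rV n]_y h v y.
  (* Doubling allows one copy to be symmetrized by Tonelli: the two terms given by AM-GM are [h v y]
     and [h y v]. *)
  apply: lee_double.
  rewrite [X in _ <= _ + X]tonelli//.
  rewrite -[leRHS]ge0_integralD//; last 4 first.
  - by move=> v _; exact: integral_ge0.
  - exact: measurable_integral.
  - by move=> v _; exact: integral_ge0.
  - exact: (measurable_integral (lebesgue_rV n) (f := fun v y : V => h y v)).
  have gg : \int[lebesgue_rV n]_y g y * \int[lebesgue_rV n]_y g y =
      \int[lebesgue_rV n]_v \int[lebesgue_rV n]_y (g v * g y).
    rewrite -ge0_integralZr ?integral_ge0//; apply: eq_integral => v _.
    by rewrite ge0_integralZl.
  have mgg : measurable_fun setT (fun p : V * V => g p.1 * g p.2).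
    by apply: emeasurable_funM; exact: measurableT_comp.
  have gg0 v y : 0 <= g v * g y by rewrite mule_ge0.
  rewrite gg -[leLHS]ge0_integralD//; last 4 first.
  - by move=> v _; exact: integral_ge0.
  - exact: (measurable_integral (lebesgue_rV n) (f := fun v y : V => g v * g y)).
  - by move=> v _; exact: integral_ge0.
  - exact: (measurable_integral (lebesgue_rV n) (f := fun v y : V => g v * g y)).
  have mpart (f : V -> V -> \bar R) v : measurable_fun setT (fun p => f p.1 p.2) ->
      measurable_fun setT (f v).
    move=> mf; exact: (measurableT_comp mf (measurable_pair1 v)).
  apply: ge0_le_integral => //.
  - by move=> v _; rewrite adde_ge0// integral_ge0.
  - by apply: emeasurable_funD;
      exact: (measurable_integral (lebesgue_rV n) (f := fun v y : V => g v * g y)).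
  - apply: emeasurable_funD; first exact: measurable_integral.
    exact: (measurable_integral (lebesgue_rV n) (f := fun v y : V => h y v)).
  move=> v _.
  have m1 := mpart (fun v y => g v * g y) v mgg.
  have m2 := mpart h v mh.
  have m3 := mpart (fun v y => h y v) v mh'.
  rewrite -!ge0_integralD//; apply: ge0_le_integral => //.
  - by move=> y _; rewrite adde_ge0.
  - exact: emeasurable_funD.
  - exact: emeasurable_funD.
  move=> y _; rewrite /h.
  have [->|gy] := eqVneq (g y) 0; first by rewrite !mule0 mul0e !adde0 !mule_ge0.
  have [->|gv] := eqVneq (g v) 0; first by rewrite !mul0e !add0e !mule_ge0.
  rewrite !indicE !mem_set ?mule1; [|exact: gQ|exact: gQ].
  rewrite (muleC (g v) (g y)) (muleC (g v) (g (_ + _)%R)).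
  have := midpoint_log_concave_dyadic g0 gm q.+1 y v; rewrite -lE.
  rewrite -[in X in (v - l *: X)%R]opprB scalerN opprK; exact: amgm_ereal.
apply: (@le_trans _ _ ((s ^+ n)%:E * \int[lebesgue_rV n]_v \int[lebesgue_rV n]_y h v y)).
  by rewrite lee_wpmul2l// lee_fin exprn_ge0// ltW.
have mhint : measurable_fun setT (fun v => \int[lebesgue_rV n]_y h v y).
  exact: measurable_integral.
have hint0 v : 0 <= \int[lebesgue_rV n]_y h v y by exact: integral_ge0.
have sn0 : 0 <= (s ^+ n)%:E by rewrite lee_fin exprn_ge0// ltW.
have <- := @ge0_integralZl _ _ _ (lebesgue_rV n) _ measurableT _ mhint _ (fun v _ => hint0 v) sn0.
apply: lee_of_eq; apply: eq_integral => v _.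
have mu1 : measurable_fun setT (fun u : V => (u + l *: v)%R : V) by exact: measurable_rVD.
have mphi : measurable_fun setT (fun u : V => g v * (g (u + l *: v)%R * (\1_Q (s^-1 *: u))%:E)).
  apply: emeasurable_funM => //; apply: emeasurable_funM; first exact: measurableT_comp.
  by apply: measurable_indic_comp => //; exact: measurable_rVZ.
have phi0 (u : V) : 0 <= g v * (g (u + l *: v)%R * (\1_Q (s^-1 *: u))%:E) by rewrite !mule_ge0.
(* For fixed [v], substitute [u = l v + s y] in two steps: a dilation with Jacobian [s ^+ n], then a
   translation by [l v]. *)
transitivity (\int[lebesgue_rV n]_u (g v * (g (u + l *: v)%R * (\1_Q (s^-1 *: u))%:E))).
  rewrite (integral_rV_scale s0 mphi phi0); congr (_ * _); apply: eq_integral => y _.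
  by rewrite /h conv addrC scalerA mulVf ?scale1r// gt_eqF.
rewrite -[LHS](integral_rV_shift (- (l *: v))%R)//.
by apply: eq_integral => u _; rewrite subrK.
Qed.

(** This is [contraction_support] for the marginal of [f]. The condition on [z] and [w] involves
    only their last [n] coordinates, so integrating out the other [k] changes neither side and the
    exponent stays [n]. *)
Lemma contraction_support_coord k n (f : 'rV[R]_(k + n) -> \bar R) (Q : set 'rV[R]_n) (q : nat) (l : R) :
  l = (2^-1 ^+ q.+1)%R ->
  measurable_fun setT f -> (forall z, 0 <= f z) -> midpoint_log_concave f ->
  measurable Q -> (forall z, f z != 0 -> Q (rsubmx z)) ->
  ((1 - l) ^+ n)%:E * (\int[lebesgue_rV (k + n)]_z f z * \int[lebesgue_rV (k + n)]_z f z) <=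
  \int[lebesgue_rV (k + n)]_w \int[lebesgue_rV (k + n)]_z
    (f w * (f z * (\1_Q ((1 - l)^-1 *: (rsubmx z - l *: rsubmx w)))%:E)).
Proof.
move=> lE mf f0 fm mQ fQ; set s := (1 - l)%R.
have mg := measurable_marginal mf f0.
have g0 := marginal_ge0 f0.
have gm := midpoint_log_concave_marginal mf f0 fm.
have one0 y : 0 <= (\1_Q y : R)%:E by rewrite lee_fin.
have gQ y : marginal f y != 0 -> Q y.
  apply: contra_neqP => nQy.
  (* As [f] vanishes off [Q], it absorbs the indicator, which then factors out of the marginal and
     kills it at [y]. *)
  have -> : f = (fun z => f z * (\1_Q (rsubmx z))%:E).
    apply/funext => z; have [->|/fQ Qz] := eqVneq (f z) 0; first by rewrite mul0e.
    by rewrite indicE mem_set// mule1.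
  by rewrite (marginalZr (chi := fun y => (\1_Q y)%:E))// indicE memNset// mule0.
have := contraction_support lE mg g0 gm mQ gQ; rewrite -/s integral_marginal//.
move=> /le_trans; apply.
have mrsub : measurable_fun setT (fun z : 'rV[R]_(k + n) => rsubmx z).
  apply/measurable_fun_rVP => i; under eq_fun do rewrite mxE; exact: measurable_coord.
have mchi (v : 'rV[R]_n) : measurable_fun setT (fun u : 'rV[R]_n => (\1_Q (s^-1 *: (u - l *: v)) : R)%:E).
  by apply: measurable_indic_comp => //; apply: measurable_rVZ; exact: measurable_rVB.
pose W (v : 'rV[R]_n) := \int[lebesgue_rV (k + n)]_z (f z * (\1_Q (s^-1 *: (rsubmx z - l *: v)))%:E).
have W0 v : 0 <= W v by apply: integral_ge0 => z _; rewrite mule_ge0.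
have mfchi v : measurable_fun setT (fun z => f z * (\1_Q (s^-1 *: (rsubmx z - l *: v)))%:E).
  by apply: emeasurable_funM => //; exact: (measurableT_comp (mchi v)).
have mW : measurable_fun setT W.
  apply: (measurable_integral (lebesgue_rV (k + n)) (f := fun (v : 'rV[R]_n) (z : 'rV[R]_(k + n)) =>
    f z * (\1_Q (s^-1 *: (rsubmx z - l *: v)))%:E)).
    apply: emeasurable_funM; first exact: measurableT_comp.
    apply: measurable_indic_comp => //; apply: measurable_rVZ; apply: measurable_rVB.
      exact: measurableT_comp.
    exact: measurable_rVZ.
  by move=> v z; rewrite mule_ge0.
apply: lee_of_eq.
transitivity (\int[lebesgue_rV n]_v (marginal f v * W v)).
  apply: eq_integral => v _; rewrite ge0_integralZl//; last 2 first.
  - by apply: emeasurable_funM.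
  - by move=> u _; rewrite mule_ge0.
  congr (_ * _); rewrite /W -integral_marginal//; last by move=> z; rewrite mule_ge0.
  apply: eq_integral => u _.
  by rewrite (marginalZr (chi := fun u => (\1_Q (s^-1 *: (u - l *: v)))%:E)).
transitivity (\int[lebesgue_rV (k + n)]_w (f w * W (rsubmx w))).
  rewrite -integral_marginal//; last 2 first.
  - apply: emeasurable_funM mf _; exact: (measurableT_comp mW mrsub).
  - by move=> z; exact: mule_ge0.
  by apply: eq_integral => v _; rewrite marginalZr.
apply: eq_integral => w _; rewrite -[LHS]ge0_integralZl//.
by move=> z _; rewrite mule_ge0.
Qed.

End contraction.

Section contraction_halfspaces.
Context {R : realType}.
Local Open Scope ereal_scope.

Lemma dotrE n (u v : 'rV[R]_n) : dotr u v = (u *m v^T) ord0 ord0.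
Proof. by rewrite mxE; apply: eq_bigr => i _; rewrite mxE. Qed.

Lemma dotr_mulmx m n (u : 'rV[R]_m) (M : 'M[R]_(m, n)) (v : 'rV[R]_n) :
  dotr (u *m M) v = dotr u (v *m M^T).
Proof. by rewrite !dotrE trmx_mul trmxK mulmxA. Qed.

Lemma dotrDr n (c x y : 'rV[R]_n) : (dotr c (x + y) = dotr c x + dotr c y)%R.
Proof. by rewrite -big_split; apply: eq_bigr => i _; rewrite mxE mulrDr. Qed.

Lemma dotrZr n (c x : 'rV[R]_n) s : (dotr c (s *: x) = s * dotr c x)%R.
Proof. by rewrite mulr_sumr; apply: eq_bigr => i _; rewrite mxE mulrCA. Qed.

Lemma dotrBr n (c x y : 'rV[R]_n) : (dotr c (x - y) = dotr c x - dotr c y)%R.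
Proof. by rewrite -scaleN1r dotrDr dotrZr mulN1r. Qed.

Lemma dotrDl n (c d x : 'rV[R]_n) : (dotr (c + d) x = dotr c x + dotr d x)%R.
Proof. by rewrite -big_split; apply: eq_bigr => i _; rewrite mxE mulrDl. Qed.

(** In linear coordinates whose last [\rank L] entries are the products with a basis of the row
    space of [L], every form [c i] depends on these entries only, so the coordinate version
    applies. *)
Lemma contraction_halfspaces n p (f : 'rV[R]_n -> \bar R) (L : 'M[R]_(p, n))
    (I : finType) (c : I -> 'rV[R]_n) (q : nat) (l : R) :
  l = (2^-1 ^+ q.+1)%R ->
  measurable_fun setT f -> (forall z, 0 <= f z) -> midpoint_log_concave f ->
  (forall i, (c i <= L)%MS) -> (forall z, f z != 0 -> forall i, (dotr (c i) z <= 0)%R) ->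
  ((1 - l) ^+ \rank L)%:E * (\int[lebesgue_rV n]_z f z * \int[lebesgue_rV n]_z f z) <=
  \int[lebesgue_rV n]_w \int[lebesgue_rV n]_z
    (f w * (f z * (\1_[set p | forall i, (dotr (c i) p.1 <= l * dotr (c i) p.2)%R] (z, w))%:E)).
Proof.
move=> lE mf f0 fm cL fc.
have s0 : (0 < 1 - l)%R by rewrite subr_gt0 lE exprn_ilt1// ?invr_ge0// invf_lt1// ltr1n.
pose C := col_mx (row_base (L^C)%MS) (row_base L).
have fullC : row_full C.
  rewrite /row_full -addsmxE (adds_eqmx (eq_row_base _) (eq_row_base _)) addsmxC.
  exact: addsmx_compl_full.
have freeC : row_free C.
  by rewrite /row_free (eqP fullC) mxrank_compl subnK// rank_leq_col.
pose A := (pinvmx C)^T; pose B := C^T.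
have AB : A *m B = 1%:M by rewrite -trmx_mul mulmxVp// trmx1.
have BA : B *m A = 1%:M by rewrite -trmx_mul mulVpmx// trmx1.
have rsubB z : rsubmx (z *m B) = z *m (row_base L)^T.
  by rewrite /B tr_col_mx mul_mx_row row_mxKr.
have /(_ _)/submxP-/choice[u uE] i : (c i <= row_base L)%MS by rewrite eq_row_base.
have cE i z : dotr (c i) z = dotr (u i) (rsubmx (z *m B)).
  by rewrite uE dotr_mulmx rsubB.
(* [Q] is a cone, so the positive factor [(1 - l)^-1] drops out of membership and leaves
   [c i z <= l * c i w]. *)
pose Q := [set y | forall i, (dotr (u i) y <= 0)%R].
have mQ : measurable Q.
  apply: (measurable_forall (F := fun i => [set y | dotr (u i) y <= 0]))%R => i.
  by apply: measurable_ler_set => //; exact: measurable_dotr.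
have mA := measurable_rV_mulmx A.
have mB := measurable_rV_mulmx B.
have mfA : measurable_fun setT (fun x => f (x *m A)) by exact: measurableT_comp.
have [a a0 changeA] := integral_linear_change AB BA.
have fmA : midpoint_log_concave (fun x => f (x *m A)).
  by move=> x y; rewrite -scalemxAl mulmxDl; exact: fm.
have fQA z : f (z *m A) != 0 -> Q (rsubmx z).
  by move=> /fc h i; have := h i; rewrite cE -mulmxA AB mulmx1.
have := contraction_support_coord lE mfA (fun z => f0 _) fmA mQ fQA.
rewrite (changeA _ mf f0).
pose chi w z := (\1_[set p | forall i, (dotr (c i) p.1 <= l * dotr (c i) p.2)%R] (z, w) : R)%:E.
have chiE w z : (\1_Q ((1 - l)^-1 *: (rsubmx z - l *: rsubmx w)))%:E = chi (w *m A) (z *m A).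
  rewrite /chi !indicE; congr (_%:R%:E); congr nat_of_bool.
  apply/idP/idP; rewrite !inE /Q/= => h i; have := h i; rewrite !cE -!mulmxA AB !mulmx1.
    by rewrite dotrZr pmulr_rle0 ?invr_gt0// dotrBr dotrZr subr_le0.
  by rewrite dotrZr pmulr_rle0 ?invr_gt0// dotrBr dotrZr subr_le0.
have mchi : measurable_fun setT (fun p : 'rV[R]_n * 'rV[R]_n => chi p.1 p.2).
  rewrite /chi; apply: measurable_indic_comp; last first.
    by apply: measurable_fun_pair; [exact: measurable_snd|exact: measurable_fst].
  apply: (measurable_forall (F := fun i =>
    [set p : 'rV[R]_n * 'rV[R]_n | dotr (c i) p.1 <= l * dotr (c i) p.2]))%R => i.
  apply: measurable_ler_set.
    exact: (measurableT_comp (measurable_dotr (c i)) measurable_fst).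
  apply: measurable_funM => //.
  exact: (measurableT_comp (measurable_dotr (c i)) measurable_snd).
pose F w z := f w * (f z * chi w z).
have F0 w z : 0 <= F w z by rewrite !mule_ge0// lee_fin.
have mF : measurable_fun setT (fun p : 'rV[R]_n * 'rV[R]_n => F p.1 p.2).
  apply: emeasurable_funM; first exact: (measurableT_comp mf measurable_fst).
  apply: emeasurable_funM mchi; exact: (measurableT_comp mf measurable_snd).
have mFw w : measurable_fun setT (F w) by exact: (measurableT_comp mF (measurable_pair1 w)).
pose W w := \int[lebesgue_rV n]_z F w z.
have W0 w : 0 <= W w by exact: integral_ge0.
have mW : measurable_fun setT W by exact: measurable_integral.
(* Each of the two integrals on either side costs one Jacobian [a], so [a * a] cancels. *)
rewrite [leRHS](_ : _ = (a * a)%:E * \int[lebesgue_rV n]_w W w); last first.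
  transitivity (\int[lebesgue_rV (\rank L^C + \rank L)]_w (a%:E * W (w *m A))).
    apply: eq_integral => w _; rewrite /W -(changeA _ (mFw _) (F0 _)).
    by apply: eq_integral => z _; rewrite chiE.
  rewrite ge0_integralZl ?lee_fin ?(ltW a0)//; last exact: measurableT_comp.
  by rewrite (changeA _ mW W0) EFinM muleA.
set Z := \int[lebesgue_rV n]_z f z; set S := (_ ^+ _)%:E.
have -> : S * (a%:E * Z * (a%:E * Z)) = (a * a)%:E * (S * (Z * Z)).
  by rewrite muleACA -EFinM [LHS]muleCA.
by rewrite (@lee_pmul2l _ (a * a)%:E)// lte_fin mulr_gt0.
Qed.

End contraction_halfspaces.

(** * The homogenized polytope *)

Section gamma.
Context {R : realType}.
Local Notation mu := (@lebesgue_measure R).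

(** The primitive of [t^n e^-t] given by repeated integration by parts; it equals [- n!] at [0] and
    tends to [0] at infinity. *)
Fixpoint gamma_primitive n (t : R) : R :=
  if n is n'.+1 then n%:R * gamma_primitive n' t - t ^+ n * expR (- t)
  else - expR (- t).

Let is_derive_expRN (t : R) : is_derive t 1 (fun t => expR (- t)) (- expR (- t)).
Proof. by apply: is_derive_eq; rewrite mulrN1. Qed.

Let is_derive_gamma_primitive n (t : R) :
  is_derive t 1 (gamma_primitive n) (t ^+ n * expR (- t)).
Proof.
elim: n => [|n IH] /=.
  by rewrite expr0 mul1r -[X in is_derive _ _ _ X]opprK; exact: is_deriveN.
have dX : is_derive t 1 (fun t : R => t ^+ n.+1) (n.+1%:R * t ^+ n).
  have := is_deriveX n.+1 (is_derive_id t 1).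
  by rewrite exprfctE/= /GRing.scale/= mulr1.
have := is_deriveB (is_deriveZ n.+1%:R IH) (is_deriveM dX (is_derive_expRN t)).
rewrite /GRing.scale/= => /is_derive_eq; apply; ring.
Qed.

Let cvg_expr_expRN n : (fun t : R => t ^+ n * expR (- t)) x @[x --> +oo] --> (0 : R).
Proof.
(* The upper bound comes from [e^t >= t^(n+1) / (n+1)!]. *)
apply: (@squeeze_cvgr _ _ _ _ (cst 0) (fun t => n.+1`!%:R * t^-1)).
- near=> t; have t0 : 0 < t by near: t; exact: nbhs_pinfty_gt.
  apply/andP; split; first by rewrite mulr_ge0 ?exprn_ge0 ?expR_ge0 ?ltW.
  rewrite expRN ler_pdivrMr ?expR_gt0// mulrAC ler_pdivlMr// -exprSr.
  rewrite -ler_pdivrMl ?ltr0n ?fact_gt0// mulrC.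
  by apply: le_trans (expR_ge1Dxn n (ltW t0)); rewrite lerDr.
- exact: cvg_cst.
- rewrite -(mulr0 n.+1`!%:R); apply: cvgMl_tmp.
  by apply/gtr0_cvgV0 => //; near=> t; near: t; exact: nbhs_pinfty_gt.
Unshelve. all: by end_near. Qed.

Lemma gamma_integral n :
  (\int[mu]_(t in `]0%R, +oo[) (t ^+ n * expR (- t))%:E = (n`!%:R : R)%:E)%E.
Proof.
have cF : (gamma_primitive n) x @[x --> +oo] --> (0 : R).
  elim: n => [|n IH] /=.
    rewrite -oppr0; apply: cvgN; exact: cvgr_expR.
  rewrite -(subr0 0) -{1}(mulr0 n.+1%:R); apply: cvgB; last exact: cvg_expr_expRN.
  exact: cvgMl_tmp.
have F0 : gamma_primitive n 0 = - n`!%:R.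
  elim: n {cF} => [|n IH] /=; first by rewrite oppr0 expR0.
  by rewrite IH expr0n/= mul0r subr0 factS natrM mulrN.
have dF t : derivable (gamma_primitive n) t 1 by have [] := is_derive_gamma_primitive n t.
have cf : continuous (fun t : R => t ^+ n * expR (- t)).
  move=> t; apply: cvgM; first exact: exprn_continuous.
  apply: continuous_comp; first exact: opp_continuous.
  exact: continuous_expR.
rewrite integral_itv_obnd_cbnd//; last first.
  by apply/measurable_EFinP/measurable_funTS; exact: continuous_measurable_fun.
rewrite (@ge0_continuous_FTC2y R _ (gamma_primitive n) 0 0)//.
- by rewrite F0 -EFinN opprK -EFinD add0r.
- by move=> x x0; rewrite mulr_ge0 ?exprn_ge0 ?expR_ge0.
- exact: continuous_subspaceT.
- apply: cvg_at_right_filter; apply: differentiable_continuous.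
  exact/derivable1_diffP.
- by move=> x _; rewrite derive1E; have [_] := is_derive_gamma_primitive n x.
Qed.

End gamma.

Section hyperplane.
Context {R : realType}.
Local Open Scope ereal_scope.

Lemma dotr_rV_cons n (s t : R) (x y : 'rV[R]_n) :
  dotr (rV_cons (s, x)) (rV_cons (t, y)) = (s * t + dotr x y)%R.
Proof.
rewrite /dotr big_ord_recl !rV_cons0; congr (_ + _)%R.
by apply: eq_bigr => i _; rewrite !rV_consS.
Qed.

Lemma measurable_hyperplane n (c : 'rV[R]_n) : measurable [set x | dotr c x = 0%R].
Proof.
have m0 : measurable [set 0%R : R] by exact: measurable_set1.
rewrite -[X in measurable X]setTI; exact: (measurable_dotr c measurableT m0).
Qed.

(** Fubini in the first coordinate. If its coefficient is nonzero, each line in that direction meets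
    the hyperplane in one point; otherwise every slice is a hyperplane one dimension lower. *)
Lemma lebesgue_rV_hyperplane n (c : 'rV[R]_n) : c != 0%R ->
  lebesgue_rV n [set x | dotr c x = 0%R] = 0.
Proof.
elim: n c => [|n IH] c; first by rewrite thinmx0 eqxx.
rewrite -[c]rV_unconsK; case: (rV_uncons c) => s y.
set H := [set x | _] => c0.
have mH : measurable H by exact: measurable_hyperplane.
have m1 : measurable_fun setT (fun x => (\1_H x : R)%:E).
  by apply/measurable_EFinP; exact: measurable_indic.
transitivity (\int[lebesgue_rV n.+1]_x (\1_H x)%:E).
  by rewrite integral_indic// setIT.
rewrite integral_rVS//.
have [s0|s0] := eqVneq s 0%R.
  apply: integral0_eq => t _.
  have y0 : y != 0%R.
    apply: contra_neq c0 => ->; rewrite s0; apply/rowP => i.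
    by case: (unliftP ord0 i) => [j|] ->; rewrite ?rV_consS ?rV_cons0 !mxE.
  rewrite -(IH _ y0); have mHy := measurable_hyperplane y.
  transitivity (\int[lebesgue_rV n]_x (\1_[set x | dotr y x = 0%R] x)%:E); last first.
    by rewrite integral_indic// setIT.
  apply: eq_integral => x _; rewrite !indicE; congr (_%:R%:E); congr nat_of_bool.
  by apply/idP/idP; rewrite !inE/= /H/= dotr_rV_cons s0 mul0r add0r.
rewrite tonelli//; last exact: (measurableT_comp m1 (@measurable_rV_cons R n)).
apply: integral0_eq => x _.
rewrite -(lebesgue_measure_set1 (- (s^-1 * dotr y x))%R).
transitivity (\int[lebesgue_measure]_t (\1_[set (- (s^-1 * dotr y x))%R] t)%:E); last first.
  by rewrite integral_indic// setIT.
apply: eq_integral => t _; rewrite !indicE; congr (_%:R%:E); congr nat_of_bool.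
apply/idP/idP; rewrite !inE/= /H/= dotr_rV_cons => h.
  by apply: (mulfI s0); rewrite mulrN mulVKf//; lra.
by rewrite h mulrN mulVKf// addNr.
Qed.

End hyperplane.

Section cone_integral.
Context {R : realType} {n m : nat}.
Variable a : 'I_m -> 'rV[R]_n.
Local Notation mu := (@lebesgue_measure R).
Local Notation P := (halfspaces a).
Local Open Scope ereal_scope.

(* [height > 0] makes the slice at height [t] exactly [t P]. *)
Definition homogeneous_cone : set 'rV[R]_n.+1 := [set z |
  (0 < (rV_uncons z).1)%R /\ forall j, (dotr (a j) (rV_uncons z).2 <= (rV_uncons z).1)%R].

Lemma measurable_height : measurable_fun setT (fun z : 'rV[R]_n.+1 => (rV_uncons z).1 : R).
Proof. exact: (measurableT_comp measurable_fst (@measurable_rV_uncons R n)). Qed.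

Lemma measurable_base : measurable_fun setT (fun z : 'rV[R]_n.+1 => (rV_uncons z).2).
Proof. exact: (measurableT_comp measurable_snd (@measurable_rV_uncons R n)). Qed.

Lemma measurable_dotr_base (c : 'rV[R]_n) :
  measurable_fun setT (fun z : 'rV[R]_n.+1 => dotr c (rV_uncons z).2).
Proof. exact: (measurableT_comp (measurable_dotr c) measurable_base). Qed.

Lemma measurable_homogeneous_cone : measurable homogeneous_cone.
Proof.
apply: measurableI; first exact: (measurable_ltr_set (measurable_cst _) measurable_height).
apply: measurable_forall => j.
exact: (measurable_ler_set (measurable_dotr_base _) measurable_height).
Qed.

Lemma measurable_halfspaces : measurable P.
Proof.
apply: measurable_forall => j.
exact: (measurable_ler_set (measurable_dotr _) (measurable_cst _)).
Qed.

(** The slice at height [t] is [t P]: rescaling it to [P] gives [t^n], and homogeneity of [phi]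
    gives [t^k]. *)
Lemma homogeneous_cone_integral k (phi : 'rV[R]_n -> \bar R) (psi : R -> R) :
  measurable_fun setT phi -> (forall x, 0 <= phi x) ->
  (forall s x, (0 < s)%R -> phi (s *: x)%R = (s ^+ k)%:E * phi x) ->
  measurable_fun setT psi -> (forall t, (0 <= psi t)%R) ->
  \int[lebesgue_rV n.+1]_z ((\1_homogeneous_cone z)%:E *
     (phi (rV_uncons z).2 * (psi (rV_uncons z).1)%:E)) =
  \int[mu]_(t in `]0%R, +oo[) (t ^+ (n + k) * psi t)%:E * \int[lebesgue_rV n]_(x in P) phi x.
Proof.
move=> mphi phi0 phiZ mpsi psi0.
have mC := measurable_homogeneous_cone.
have mP := measurable_halfspaces.
have mEpsi : measurable_fun setT (EFin \o psi) by exact/measurable_EFinP.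
have m1 : measurable_fun setT (fun z => (\1_homogeneous_cone z : R)%:E).
  by apply/measurable_EFinP; exact: measurable_indic.
rewrite integral_rVS; last 2 first.
- apply: emeasurable_funM m1 _; apply: emeasurable_funM.
    exact: (measurableT_comp mphi measurable_base).
  exact: (measurableT_comp mEpsi measurable_height).
- by move=> z; rewrite !mule_ge0 ?lee_fin.
rewrite -ge0_integralZr//; last 3 first.
- apply/measurable_EFinP/measurable_funTS; apply: measurable_funM mpsi.
  exact: exprn_measurable.
- move=> t; rewrite /= in_itv/= andbT => t0.
  by rewrite lee_fin mulr_ge0// exprn_ge0// ltW.
- exact: integral_ge0.
rewrite [RHS]integral_mkcond; apply: eq_integral => t _.
rewrite patchE; case: ifPn => ht; last first.
  have t0 : ~ (0 < t)%R by move: ht; rewrite notin_setE/= in_itv/= andbT.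
  apply: integral0_eq => x _; rewrite rV_consK indicE memNset ?mul0e//.
  by rewrite /homogeneous_cone/mkset rV_consK => -[/t0].
have t0 : (0 < t)%R by move: ht; rewrite inE/= in_itv/= andbT.
have mcons := @measurable_rV_cons2 R n t.
pose g x := (\1_homogeneous_cone (rV_cons (t, x)))%:E * (phi x * (psi t)%:E).
have mg : measurable_fun setT g.
  apply: emeasurable_funM; first exact: (measurableT_comp m1 mcons).
  by apply: emeasurable_funM.
have g0 x : 0 <= g x by rewrite !mule_ge0 ?lee_fin.
transitivity (\int[lebesgue_rV n]_x g x).
  by apply: eq_integral => x _; rewrite rV_consK.
rewrite (integral_rV_scale t0 mg g0).
rewrite exprD -mulrA EFinM -muleA; congr (_ * _).
rewrite [in RHS]integral_mkcond -ge0_integralZl//; last 3 first.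
- by apply/(measurable_restrictT _ mP); exact: measurable_funTS.
- by move=> x _; apply: erestrict_ge0.
- by rewrite lee_fin mulr_ge0// exprn_ge0// ltW.
apply: eq_integral => x _; rewrite patchE /g phiZ// indicE.
have CP : (rV_cons (t, t *: x) \in homogeneous_cone) = (x \in P).
  apply/idP/idP; rewrite !inE /homogeneous_cone/mkset rV_consK /=.
    by move=> [_ h] j; have := h j; rewrite dotrZr -[leRHS]mulr1 ler_pM2l.
  by move=> h; split=> // j; rewrite dotrZr -[leRHS]mulr1 ler_pM2l.
rewrite CP; case: ifP => xP; last by rewrite mul0e mule0.
by rewrite mul1e EFinM muleAC.
Qed.

End cone_integral.

Section cone_density.
Context {R : realType} {n m : nat}.
Variable a : 'I_m -> 'rV[R]_n.
Local Notation mu := (@lebesgue_measure R).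
Local Notation P := (halfspaces a).
Local Notation C := (homogeneous_cone a).
Local Notation height z := (rV_uncons z).1.
Local Notation base z := (rV_uncons z).2.
Implicit Types (u v : 'rV[R]_n.+1 -> R) (z : 'rV[R]_n.+1).

Definition cone_density z : R := \1_C z * expR (- height z).

(** The expectation of [u] before normalization; the total mass is [n! vol P], see [cone_mass1]. *)
Definition cone_mass u : \bar R := (\int[lebesgue_rV n.+1]_z (cone_density z * u z)%:E)%E.

Lemma measurable_cone_density : measurable_fun setT cone_density.
Proof.
apply: measurable_funM; first by apply: measurable_indic; exact: measurable_homogeneous_cone.
apply: (measurableT_comp (@measurable_expR R)).
by apply: measurable_funN; exact: measurable_height.
Qed.

Lemma cone_density_out z : ~ C z -> cone_density z = 0.
Proof. by move=> Cz; rewrite /cone_density indicE memNset// mul0r. Qed.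

Lemma cone_densityE z : C z -> cone_density z = expR (- height z).
Proof. by move=> Cz; rewrite /cone_density indicE mem_set// mul1r. Qed.

Lemma cone_density_ge0 z : 0 <= cone_density z.
Proof. by rewrite mulr_ge0// expR_ge0. Qed.

Lemma cone_density_mul_ge0 u z : (C z -> 0 <= u z) -> (0 <= (cone_density z * u z)%:E)%E.
Proof.
move=> u0; rewrite lee_fin; have [/u0 uz|Cz] := pselect (C z).
  by rewrite mulr_ge0// cone_density_ge0.
by rewrite cone_density_out// mul0r.
Qed.

Let measurable_density_mul u : measurable_fun setT u ->
  measurable_fun setT (fun z => (cone_density z * u z)%:E).
Proof. by move=> mu'; apply/measurable_EFinP/measurable_funM => //; exact: measurable_cone_density. Qed.

Lemma cone_mass_ge0 u : (forall z, C z -> 0 <= u z) -> (0 <= cone_mass u)%E.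
Proof. by move=> u0; apply: integral_ge0 => z _; apply: cone_density_mul_ge0; exact: u0. Qed.

Lemma le_cone_mass u v : measurable_fun setT u -> measurable_fun setT v ->
  (forall z, C z -> 0 <= u z) -> (forall z, C z -> u z <= v z) ->
  (cone_mass u <= cone_mass v)%E.
Proof.
move=> mu' mv u0 uv; apply: ge0_le_integral => //.
- by move=> z _; apply: cone_density_mul_ge0; exact: u0.
- exact: measurable_density_mul.
- exact: measurable_density_mul.
move=> z _; rewrite lee_fin; have [Cz|Cz] := pselect (C z).
  by rewrite ler_wpM2l ?cone_density_ge0// uv.
by rewrite cone_density_out// !mul0r.
Qed.

Lemma eq_cone_mass u v : (forall z, C z -> u z = v z) -> cone_mass u = cone_mass v.
Proof.
move=> uv; apply: eq_integral => z _; have [Cz|Cz] := pselect (C z); first by rewrite uv.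
by rewrite cone_density_out// !mul0r.
Qed.

Lemma cone_massD u v : measurable_fun setT u -> measurable_fun setT v ->
  (forall z, C z -> 0 <= u z) -> (forall z, C z -> 0 <= v z) ->
  (cone_mass (fun z => (u z + v z)%R) = cone_mass u + cone_mass v)%E.
Proof.
move=> mu' mv u0 v0; rewrite /cone_mass -ge0_integralD//.
- by apply: eq_integral => z _; rewrite mulrDr EFinD.
- by move=> z _; apply: cone_density_mul_ge0; exact: u0.
- exact: measurable_density_mul.
- by move=> z _; apply: cone_density_mul_ge0; exact: v0.
- exact: measurable_density_mul.
Qed.

Lemma cone_massZ (c : R) u : 0 <= c -> measurable_fun setT u ->
  (forall z, C z -> 0 <= u z) -> (cone_mass (fun z => (c * u z)%R) = c%:E * cone_mass u)%E.
Proof.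
move=> c0 mu' u0; have md := measurable_density_mul mu'.
rewrite /cone_mass -ge0_integralZl//.
- by apply: eq_integral => z _; rewrite mulrCA EFinM.
- by move=> z _; apply: cone_density_mul_ge0; exact: u0.
Qed.

Lemma cone_mass_sum (I : pred 'I_m) (u : 'I_m -> 'rV[R]_n.+1 -> R) :
  (forall i, measurable_fun setT (u i)) -> (forall i z, C z -> 0 <= u i z) ->
  (cone_mass (fun z => (\sum_(i | I i) u i z)%R) = \sum_(i | I i) cone_mass (u i))%E.
Proof.
move=> mu' u0; rewrite /index_enum; elim: (Finite.enum _) => [|i r IH].
  rewrite big_nil; apply: integral0_eq => z _; by rewrite big_nil mulr0.
rewrite big_cons -IH; case: ifPn => Ii.
  have ms : measurable_fun setT (fun z => \sum_(j <- r | I j) u j z).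
    under eq_fun do rewrite -big_filter; exact: measurable_sum.
  have s0 z : C z -> 0 <= \sum_(j <- r | I j) u j z.
    by move=> Cz; apply: sumr_ge0 => j _; exact: u0.
  rewrite -(cone_massD (mu' i) ms (u0 i) s0).
  by apply: eq_cone_mass => z _; rewrite big_cons Ii.
by apply: eq_cone_mass => z _; rewrite big_cons (negPf Ii).
Qed.

Lemma cone_mass_base k (phi : 'rV[R]_n -> R) :
  measurable_fun setT phi -> (forall x, 0 <= phi x) ->
  (forall s x, 0 < s -> phi (s *: x) = s ^+ k * phi x) ->
  (cone_mass (fun z => phi (base z)) =
   (n + k)`!%:R%:E * \int[lebesgue_rV n]_(x in P) (phi x)%:E)%E.
Proof.
move=> mphi phi0 phiZ; rewrite -gamma_integral.
rewrite -(homogeneous_cone_integral a (k := k) (phi := EFin \o phi) (psi := fun t => expR (- t)))//.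
- by apply: eq_integral => z _; rewrite /cone_density -!EFinM mulrAC -mulrA.
- exact/measurable_EFinP.
- by move=> s x s0; rewrite /= phiZ.
- apply: (measurableT_comp (@measurable_expR R)); exact: oppr_measurable.

Qed.

Lemma cone_mass1 : (cone_mass (fun=> 1%R) = n`!%:R%:E * vol P)%E.
Proof.
rewrite (cone_mass_base (k := 0) (phi := fun=> 1)); last 3 first.
- exact: measurable_cst.
- by [].
- by move=> s x _; rewrite mul1r.
rewrite addn0 integral_cst ?mul1e//; exact: measurable_halfspaces.
Qed.

(** Compared with [cone_mass1], this says that the mean height is [n + 1]. *)
Lemma cone_mass_height : (cone_mass (fun z => height z) = n.+1`!%:R%:E * vol P)%E.
Proof.
have mP := @measurable_halfspaces R n m a.
rewrite -gamma_integral.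
have -> : vol P = (\int[lebesgue_rV n]_(x in P) 1)%E by rewrite integral_cst ?mul1e.
(* The absolute value makes the weight nonnegative on the whole line, as [homogeneous_cone_integral]
   asks; it agrees with [t] on the half-line. *)
transitivity (\int[mu]_(t in `]0%R, +oo[) (t ^+ (n + 0) * (`|t| * expR (- t)))%:E *
    \int[lebesgue_rV n]_(x in P) 1)%E; last first.
  congr (_ * _)%E; apply: eq_integral => t; rewrite inE/= in_itv/= andbT => t0.
  by rewrite addn0 gtr0_norm// exprSr mulrA.
rewrite -(homogeneous_cone_integral a (k := 0) (phi := fun=> 1%E) (psi := fun t => `|t| * expR (- t)))//.
- apply: eq_integral => z _; have [Cz|Cz] := pselect (C z); last first.
    by rewrite cone_density_out// mul0r indicE memNset// mul0e.
  rewrite cone_densityE// indicE mem_set// !mul1e gtr0_norm; first by rewrite mulrC.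
  by case: Cz.
- by move=> s x _; rewrite mul1e.
- apply: measurable_funM; first exact: normr_measurable.
  apply: (measurableT_comp (@measurable_expR R)); exact: oppr_measurable.
Qed.

(** The cone is convex and the logarithm of the density is linear on it. *)
Lemma cone_density_midpoint : midpoint_log_concave (fun z => (cone_density z)%:E).
Proof.
move=> x y; rewrite -!EFinM lee_fin.
have [Cx|Cx] := pselect (C x); last first.
  by rewrite (cone_density_out Cx) mul0r mulr_ge0 ?cone_density_ge0.
have [Cy|Cy] := pselect (C y); last first.
  by rewrite (cone_density_out Cy) mulr0 mulr_ge0 ?cone_density_ge0.
have E : rV_uncons (2^-1 *: (x + y)) =
    (2^-1 * (height x + height y), 2^-1 *: (base x + base y)).
  rewrite -{1}[x]rV_unconsK -{1}[y]rV_unconsK.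
  case: (rV_uncons x) (rV_uncons y) => [s u] [t v].
  by rewrite rV_consD rV_consZ rV_consK.
have Eh : height (2^-1 *: (x + y)) = 2^-1 * (height x + height y) by rewrite E.
have Eb : base (2^-1 *: (x + y)) = 2^-1 *: (base x + base y) by rewrite E.
rewrite !cone_densityE//.
  by rewrite -!expRD ler_expR Eh; lra.
case: Cx Cy => [x0 xa] [y0 ya]; rewrite /homogeneous_cone/mkset Eh Eb; split; first lra.
by move=> j; rewrite dotrZr dotrDr; have := xa j; have := ya j; lra.
Qed.

End cone_density.

(** * The parts of the cone above the individual facets *)

Section strict_cone.
Context {R : realType} {n m : nat}.
Variable a : 'I_m -> 'rV[R]_n.
Local Notation P := (halfspaces a).
Local Notation C := (homogeneous_cone a).
Local Notation height z := (rV_uncons z).1.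
Local Notation base z := (rV_uncons z).2.
Local Notation mass := (cone_mass a).
Local Notation density := (cone_density a).
Implicit Types (u v : 'rV[R]_n.+1 -> R) (z : 'rV[R]_n.+1) (i j : 'I_m).

(** For an irredundant description this is the cone spanned by the facet [F_i] up to a null set;
    strictness makes the cones of different facets disjoint. *)
Definition strict_cone i : set 'rV[R]_n := [set x | 0 < dotr (a i) x /\
  forall j, j != i -> dotr (a j) x < dotr (a i) x].

Definition gap i z : R := height z - dotr (a i) (base z).

Lemma measurable_strict_cone i : measurable (strict_cone i).
Proof.
apply: measurableI.
  exact: (measurable_ltr_set (measurable_cst _) (measurable_dotr _)).
apply: (measurable_forall (F := fun j => [set x | j != i -> dotr (a j) x < dotr (a i) x])) => j.
have [->|ji] := eqVneq j i.
  by rewrite (_ : [set x | _] = setT)//; apply/seteqP; split.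
rewrite (_ : [set x | _] = [set x | dotr (a j) x < dotr (a i) x]).
  exact: (measurable_ltr_set (measurable_dotr _) (measurable_dotr _)).
by apply/seteqP; split=> x /=; [apply|move=> ? _].
Qed.

Lemma strict_cone_disjoint i j x : strict_cone i x -> strict_cone j x -> i = j.
Proof.
move=> [_ hi] [_ hj]; apply/eqP; apply: contraT => ij.
by have := hj _ ij; rewrite ltNge ltW// hi// eq_sym.
Qed.

Lemma measurable_gap i : measurable_fun setT (gap i).
Proof. apply: measurable_funB; [exact: measurable_height|exact: measurable_dotr_base]. Qed.

Lemma gap_ge0 i z : C z -> 0 <= gap i z.
Proof. by move=> [_ h]; rewrite subr_ge0. Qed.

Let measurable_indic_strict_cone i : measurable_fun setT (fun z => \1_(strict_cone i) (base z) : R).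
Proof.
apply: (measurableT_comp (f := \1_(strict_cone i) : 'rV[R]_n -> R)); last exact: measurable_base.
by apply: measurable_indic; exact: measurable_strict_cone.
Qed.

Let measurable_bool_gap i (c : R) : measurable_fun setT (fun z => (c <= gap i z)%R%:R : R).
Proof.
rewrite (_ : (fun _ => _) = \1_[set z | c <= gap i z]).
  apply: measurable_indic.
  exact: (measurable_ler_set (measurable_cst _) (measurable_gap i)).
by apply/funext => z; rewrite indicE; congr (_%:R); congr nat_of_bool; apply/idP/idP; rewrite inE.
Qed.

Lemma cone_mass_strict_cone i :
  (mass (fun z => \1_(strict_cone i) (base z)) = n`!%:R%:E * lebesgue_rV n (strict_cone i `&` P))%E.
Proof.
rewrite (cone_mass_base a (k := 0) (phi := \1_(strict_cone i) : _ -> R)).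
- rewrite addn0; congr (_ * _)%E.
  rewrite integral_indic//; first exact: measurable_halfspaces.
  exact: measurable_strict_cone.
- by apply: measurable_indic; exact: measurable_strict_cone.
- by move=> x.
move=> s x s0; rewrite expr0 mul1r !indicE; congr (_%:R); congr nat_of_bool.
apply/idP/idP; rewrite !inE => -[x0 h]; split.
- by move: x0; rewrite dotrZr pmulr_rgt0.
- by move=> j /h; rewrite !dotrZr ltr_pM2l.
- by rewrite dotrZr pmulr_rgt0.
- by move=> j /h; rewrite !dotrZr ltr_pM2l.
Qed.

(* Translating by [c] in height maps the part of the cone over [strict_cone i]
   onto its part with [gap] at least [c]. *)
Lemma cone_mass_gap i (c : R) : 0 <= c ->
  (mass (fun z => (\1_(strict_cone i) (base z) * (c <= gap i z)%R%:R)%R) =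
  (expR (- c))%:E * mass (fun z => \1_(strict_cone i) (base z)))%E.
Proof.
move=> c0; pose b : 'rV[R]_n.+1 := rV_cons (- c, 0).
pose G z := (density z * \1_(strict_cone i) (base z))%:E.
have mG : measurable_fun setT G.
  apply/measurable_EFinP; apply: measurable_funM => //; exact: measurable_cone_density.
have G0 z : (0 <= G z)%E by rewrite lee_fin mulr_ge0// cone_density_ge0.
have mGb : measurable_fun setT (fun z : 'rV[R]_n.+1 => G (z + b)).
  by apply: (measurableT_comp mG); exact: measurable_rVD.
rewrite /cone_mass -/G -(integral_rV_shift b mG G0) -ge0_integralZl//.
apply: eq_integral => z _; rewrite /G -EFinM; congr EFin.
have E : rV_uncons (z + b) = (height z - c, base z).
  rewrite -{1}[z]rV_unconsK /b; case: (rV_uncons z) => t x.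
  by rewrite rV_consD rV_consK addr0.
have Eh : height (z + b) = height z - c by rewrite E.
have Eb : base (z + b) = base z by rewrite E.
rewrite Eb !indicE; case: (boolP (base z \in _)) => [|_]; last by rewrite mul0r !mulr0.
rewrite inE => -[x0 h]; rewrite mul1r mulr1.
have [cg|gc] := leP c (gap i z).
  (* Over [strict_cone i] the constraint of [a i] implies all others and the positivity of the
     height, so it alone decides whether the translate is in the cone. *)
  have ai : dotr (a i) (base z) <= height z - c by rewrite lerBrDr addrC -lerBrDr.
  have aj j : dotr (a j) (base z) <= height z - c.
    have [->//|ji] := eqVneq j i; exact: le_trans (ltW (h _ ji)) ai.
  rewrite !cone_densityE ?Eh//.
  - by rewrite mulr1 -expRD; congr expR; lra.
  - by split; rewrite ?Eh ?Eb//; exact: lt_le_trans ai.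
  - split; first by apply: lt_le_trans x0 _; apply: le_trans ai _; rewrite lerBlDr lerDl.
    by move=> j; apply: le_trans (aj j) _; rewrite lerBlDr lerDl.
rewrite mulr0 (@cone_density_out _ _ _ _ (z + b)) ?mulr0//.
move=> [_ /(_ i)]; rewrite Eh Eb => hi.
by move: gc; rewrite ltNge => /negP; apply; rewrite /gap; lra.
Qed.

(** The inclusion of the disjoint events [gap i z < c i] over [strict_cone i] in the complement of
    the first event, integrated and written without subtraction. Pointwise, at most one term of each
    sum is nonzero. *)
Lemma cone_mass_gap_ge (I : pred 'I_m) (c : 'I_m -> R) : (forall i, 0 <= c i) ->
  (mass (\1_[set z | forall i, I i -> (c i <= gap i z)%R]) +
   \sum_(i | I i) mass (fun z => \1_(strict_cone i) (base z)) <=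
   mass (fun=> 1%R) +
   \sum_(i | I i) (expR (- c i))%:E * mass (fun z => \1_(strict_cone i) (base z)))%E.
Proof.
move=> c0.
under [in leRHS]eq_bigr => i _ do rewrite -cone_mass_gap//.
have mi i : measurable_fun setT (fun z => \1_(strict_cone i) (base z) * (c i <= gap i z)%R%:R : R).
  exact: measurable_funM.
have i0 i z : C z -> (0 : R) <= \1_(strict_cone i) (base z) * (c i <= gap i z)%R%:R.
  by rewrite mulr_ge0.
rewrite -(cone_mass_sum I mi i0) -cone_mass_sum//.
have mE : measurable_fun setT (\1_[set z | forall i, I i -> (c i <= gap i z)%R] : _ -> R).
  apply: measurable_indic.
  apply: (measurable_forall (F := fun i => [set z | I i -> c i <= gap i z])) => i.
  have [Ii|nIi] := boolP (I i).
    rewrite (_ : [set z | _] = [set z | c i <= gap i z]).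
      exact: (measurable_ler_set (measurable_cst _) (measurable_gap i)).
    by apply/seteqP; split=> x /=; [apply|move=> ? _].
  by rewrite (_ : [set z | _] = setT)//; apply/seteqP; split.
have ms1 : measurable_fun setT (fun z => \sum_(i | I i) \1_(strict_cone i) (base z) : R).
  under eq_fun do rewrite -big_filter; exact: measurable_sum.
have ms2 : measurable_fun setT (fun z => \sum_(i | I i) (\1_(strict_cone i) (base z) * (c i <= gap i z)%R%:R) : R).
  by under eq_fun do rewrite -big_filter; apply: measurable_sum => i; exact: measurable_funM.
have s10 z : C z -> 0 <= \sum_(i | I i) \1_(strict_cone i) (base z) :> R.
  by move=> _; exact: sumr_ge0.
have s20 z : C z -> 0 <= \sum_(i | I i) (\1_(strict_cone i) (base z) * (c i <= gap i z)%R%:R) :> R.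
  by move=> _; apply: sumr_ge0 => i _; rewrite mulr_ge0.
rewrite -!cone_massD//.
apply: le_cone_mass => //.
- exact: measurable_funD.
- exact: measurable_funD.
- by move=> z Cz; rewrite addr_ge0// s10.
move=> z Cz.
have [[i [Ii xi]]|nI] := pselect (exists i, I i /\ strict_cone i (base z)).
  have uniq (F : 'I_m -> R) : \sum_(j | I j) \1_(strict_cone j) (base z) * F j = F i.
    rewrite (bigD1 i)//= big1 ?addr0 => [|j /andP[_ ji]].
      by rewrite indicE mem_set// mul1r.
    rewrite indicE memNset ?mul0r// => xj; move/eqP: ji; apply.
    exact: (strict_cone_disjoint xj xi).
  have := uniq (fun=> 1); under eq_bigr do rewrite mulr1; move=> ->.
  rewrite (uniq (fun j => (c j <= gap j z)%R%:R)) addrC lerD2l indicE.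
  by case: (boolP (z \in _)) => //; rewrite inE => /(_ i Ii) ->.
rewrite big1 ?addr0 => [|i Ii]; last first.
  by rewrite indicE memNset// => xi; apply: nI; exists i.
rewrite big1 ?addr0 => [|i Ii]; last first.
  by rewrite indicE memNset ?mul0r// => xi; apply: nI; exists i.
by rewrite indicE; case: (_ \in _).
Qed.

(** [gap] and height differ by a linear form whose positive and negative parts have equal mass.
    Adding the positive part to [gap] and the negative part to the height keeps all integrands
    nonnegative; finiteness allows cancelling. *)
Lemma cone_mass_gapE i :
  (\int[lebesgue_rV n]_(x in P) (Num.max (dotr (a i) x) 0)%:E =
   \int[lebesgue_rV n]_(x in P) (Num.max (- dotr (a i) x) 0)%:E)%E ->
  (\int[lebesgue_rV n]_(x in P) (Num.max (dotr (a i) x) 0)%:E < +oo)%E ->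
  (mass (gap i) = n.+1`!%:R%:E * vol P)%E.
Proof.
move=> balanced fin.
pose p x := Num.max (dotr (a i) x) 0; pose q x := Num.max (- dotr (a i) x) 0.
have mp : measurable_fun setT p.
  by apply: measurable_maxr => //; exact: measurable_dotr.
have mq : measurable_fun setT q.
  by apply: measurable_maxr => //; apply: measurable_funN; exact: measurable_dotr.
have ge0 (y : R) : 0 <= Num.max y 0 by rewrite le_max lexx orbT.
have pZ s x : 0 < s -> p (s *: x) = s ^+ 1 * p x.
  by move=> s0; rewrite /p dotrZr expr1 maxr_pMr ?ltW// mulr0.
have qZ s x : 0 < s -> q (s *: x) = s ^+ 1 * q x.
  by move=> s0; rewrite /q dotrZr expr1 maxr_pMr ?ltW// mulr0 mulrN.
have Ep := cone_mass_base a mp (fun x => ge0 _) pZ.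
have Eq := cone_mass_base a mq (fun x => ge0 _) qZ.
rewrite balanced -Eq in Ep.
have mpb : measurable_fun setT (fun z => p (base z)) by exact: (measurableT_comp mp (@measurable_base R n)).
have mqb : measurable_fun setT (fun z => q (base z)) by exact: (measurableT_comp mq (@measurable_base R n)).
have qfin : mass (fun z => q (base z)) \is a fin_num.
  rewrite ge0_fin_numE; last by apply: cone_mass_ge0 => z _; exact: ge0.
  by rewrite Eq -balanced lte_mul_pinfty// ?lee_fin.
rewrite -cone_mass_height -[LHS](addeK _ qfin) -[RHS](addeK _ qfin); congr (_ - _)%E.
rewrite -[in LHS]Ep -!cone_massD//.
- apply: eq_cone_mass => z _; rewrite /gap /p /q; set y := dotr _ _.
  have -> : Num.max y 0 = y + Num.max (- y) 0.
    by rewrite addr_maxr subrr addr0 maxC.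
  by rewrite addrA subrK.
- exact: measurable_height.
- by move=> z [/ltW].
- by move=> z _; exact: ge0.
- exact: measurable_gap.
- by move=> z; exact: gap_ge0.
- by move=> z _; exact: ge0.
Qed.

End strict_cone.

(** * The concentration inequality *)

Lemma cvg_rsum (R : realType) (J T : Type) (F : set_system T) (r : seq J) (A : pred J)
    (f : J -> T -> R) (l : J -> R) : Filter F -> (forall j, A j -> f j x @[x --> F] --> l j) ->
  \sum_(j <- r | A j) f j x @[x --> F] --> \sum_(j <- r | A j) l j.
Proof.
move=> FF fl; elim: r => [|j r IH].
  by rewrite big_nil; under eq_fun do rewrite big_nil; exact: cvg_cst.
rewrite big_cons; under eq_fun do rewrite big_cons.
by case: ifPn => Aj //; apply: cvgD => //; exact: fl.
Qed.

Section strict_cone_concentration.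
Context {R : realType} {n m p : nat}.
Variables (a : 'I_m -> 'rV[R]_n) (I : pred 'I_m) (L : 'M[R]_(p, n.+1)).
Local Notation P := (halfspaces a).
Local Notation C := (homogeneous_cone a).
Local Notation mass := (cone_mass a).
Local Notation density := (cone_density a).
Implicit Types (z w : 'rV[R]_n.+1) (i j : 'I_m).
Hypothesis P_finite : (vol P < +oo)%E.
Hypothesis IL : forall i, I i -> (rV_cons (- 1, a i) <= L)%MS.
Hypothesis balanced : forall i,
  (\int[lebesgue_rV n]_(x in P) (Num.max (dotr (a i) x) 0)%:E =
   \int[lebesgue_rV n]_(x in P) (Num.max (- dotr (a i) x) 0)%:E)%E.
Hypothesis balanced_finite : forall i,
  (\int[lebesgue_rV n]_(x in P) (Num.max (dotr (a i) x) 0)%:E < +oo)%E.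

Let Z := fine (mass (fun=> 1)).
Let M i := fine (mass (fun z => \1_(strict_cone a i) (rV_uncons z).2)).

Let massZ : mass (fun=> 1) = Z%:E.
Proof.
rewrite /Z fineK// ge0_fin_numE; last by apply: cone_mass_ge0.
by rewrite cone_mass1 lte_mul_pinfty// ?lee_fin.
Qed.

Let mass_cst (c : R) : 0 <= c -> mass (fun=> c) = (c * Z)%:E.
Proof.
move=> c0; rewrite EFinM -massZ -cone_massZ//.
by apply: eq_cone_mass => w _; rewrite mulr1.
Qed.

Let mass_fin (u : 'rV[R]_n.+1 -> R) : measurable_fun setT u -> (forall z, C z -> 0 <= u z) ->
  (forall z, C z -> u z <= 1) -> mass u \is a fin_num.
Proof.
move=> mu u0 u1; rewrite ge0_fin_numE; last exact: cone_mass_ge0.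
apply: (@le_lt_trans _ _ (mass (fun=> 1))); last by rewrite massZ ltry.
exact: le_cone_mass.
Qed.

Let measurable_indic_base i :
  measurable_fun setT (fun z : 'rV[R]_n.+1 => \1_(strict_cone a i) (rV_uncons z).2 : R).
Proof.
apply: (measurableT_comp (f := \1_(strict_cone a i) : 'rV[R]_n -> R)); last exact: measurable_base.
by apply: measurable_indic; exact: measurable_strict_cone.
Qed.

Let massM i : mass (fun z => \1_(strict_cone a i) (rV_uncons z).2) = (M i)%:E.
Proof. by rewrite /M fineK// mass_fin// => z _; rewrite indicE; case: (_ \in _). Qed.

Let Z_ge0 : 0 <= Z. Proof. by apply: fine_ge0; exact: cone_mass_ge0. Qed.

Let M_ge0 i : 0 <= M i. Proof. by apply: fine_ge0; exact: cone_mass_ge0. Qed.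

(** A lower bound for [(1 - e^(- l gap)) / l] that increases to [gap] as [l] decreases to [0], which
    suits monotone convergence. *)
Let h (l : R) i z := gap a i z * (1 + l * gap a i z) `^ (- 1).

Let measurable_h l i : measurable_fun setT (h l i).
Proof.
apply: measurable_funM; first exact: measurable_gap.
apply: (measurableT_comp (@measurable_powR R (- 1))).
by apply: measurable_funD => //; apply: measurable_funM => //; exact: measurable_gap.
Qed.

Let den_gt0 (l : R) i z : 0 <= l -> C z -> 0 < 1 + l * gap a i z.
Proof. by move=> l0 Cz; rewrite ltr_pwDl// mulr_ge0// gap_ge0. Qed.

Let hE l i z : 0 <= l -> C z -> h l i z = gap a i z / (1 + l * gap a i z).
Proof. by move=> l0 Cz; rewrite /h powR_inv1// ltW// den_gt0. Qed.

Let h_ge0 l i z : C z -> 0 <= h l i z.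
Proof. by move=> Cz; rewrite mulr_ge0 ?gap_ge0// powR_ge0. Qed.

Let one_sub_expRN (y : R) : 0 <= y -> expR (- y) + y / (1 + y) <= 1.
Proof.
move=> y0; have y1 : 0 < 1 + y by rewrite ltr_pwDl.
have : expR (- y) <= (1 + y)^-1.
  by rewrite expRN lef_pV2 ?posrE ?expR_gt0// expR_ge1Dx.
have -> : y / (1 + y) = 1 - (1 + y)^-1 by field; exact: lt0r_neq0.
lra.
Qed.

Let bernoulli (l : R) k : 0 <= l -> l <= 1 -> 1 - k%:R * l <= (1 - l) ^+ k.
Proof.
move=> l0 l1; elim: k => [|k IH]; first by rewrite mul0r subr0 expr0.
rewrite exprS; have : (1 - l) * (1 - k%:R * l) <= (1 - l) * (1 - l) ^+ k.
  by rewrite ler_wpM2l// subr_ge0.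
apply: le_trans; rewrite -[k.+1%:R]natr1.
have : 0 <= k%:R * l * l by rewrite !mulr_ge0.
by set x := k%:R; nra.
Qed.

Let exp_gap l i := fine (mass (fun z => expR (- (l * gap a i z)))).

Let measurable_exp_gap l i : measurable_fun setT (fun z => expR (- (l * gap a i z))).
Proof.
apply: (measurableT_comp (@measurable_expR R)); apply: measurable_funN.
by apply: measurable_funM => //; exact: measurable_gap.
Qed.

Let mass_exp_gap l i : 0 <= l -> mass (fun z => expR (- (l * gap a i z))) = (exp_gap l i)%:E.
Proof.
move=> l0; rewrite /exp_gap fineK// mass_fin// => z Cz.
by rewrite expR_le1 oppr_le0 mulr_ge0// gap_ge0.
Qed.

(** The contraction inequality bounds from below the mass of pairs with [gap i z >= l * gap i w] for
    all [i] in [I]. For fixed [w], [cone_mass_gap_ge] bounds the mass of such [z] from above; this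
    is then integrated over [w]. *)
Let dyadic_exp q (l : R) : l = 2^-1 ^+ q.+1 ->
  (1 - l) ^+ \rank L * (Z * Z) + Z * \sum_(i | I i) M i <=
  Z * Z + \sum_(i | I i) M i * exp_gap l i.
Proof.
move=> lE; have l0 : 0 <= l by rewrite lE exprn_ge0// invr_ge0.
pose J : finType := {i | I i}.
(* As a linear form [c i] is minus the gap, hence nonpositive on the cone. *)
pose c (i : J) : 'rV[R]_n.+1 := rV_cons (- 1, a (val i)).
have cE (i : J) z : dotr (c i) z = - gap a (val i) z.
  by rewrite -{1}[z]rV_unconsK dotr_rV_cons /gap mulN1r opprB addrC.
have md : measurable_fun setT (fun z => (density z)%:E).
  by apply/measurable_EFinP; exact: measurable_cone_density.
have d0 z : (0 <= (density z)%:E)%E by rewrite lee_fin cone_density_ge0.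
have := @contraction_halfspaces R n.+1 p (fun z => (density z)%:E) L J c q l lE md d0
  (@cone_density_midpoint R n m a).
have -> : (\int[lebesgue_rV n.+1]_z (density z)%:E)%E = Z%:E.
  by rewrite -massZ; apply: eq_integral => z _; rewrite mulr1.
have cL (i : J) : (c i <= L)%MS by apply: IL; exact: (valP i).
have cneg z : (density z)%:E != 0%E -> forall i : J, dotr (c i) z <= 0.
  move=> dz i; rewrite cE oppr_le0 gap_ge0//.
  by apply: contrapT => /cone_density_out d0'; move: dz; rewrite d0' eqxx.
move=> /(_ cL cneg).
set E2 := [set _ | _] => key.
have mE2 : measurable E2.
  apply: (measurable_forall (F := fun i : J =>
    [set p : 'rV[R]_n.+1 * 'rV[R]_n.+1 | dotr (c i) p.1 <= l * dotr (c i) p.2])) => i.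
  apply: measurable_ler_set; first exact: (measurableT_comp (measurable_dotr (c i)) measurable_fst).
  apply: measurable_funM => //; exact: (measurableT_comp (measurable_dotr (c i)) measurable_snd).
have m1E2 : measurable_fun setT (fun wz : 'rV[R]_n.+1 * 'rV[R]_n.+1 => \1_E2 (wz.2, wz.1) : R).
  apply: (measurableT_comp (f := \1_E2 : _ -> R)); first exact: measurable_indic.
  exact: measurable_fun_pair measurable_snd measurable_fst.
pose F w z := (density z * \1_E2 (z, w))%:E.
have F0 w z : (0 <= F w z)%E by rewrite lee_fin mulr_ge0// cone_density_ge0.
have mF : measurable_fun setT (fun wz : 'rV[R]_n.+1 * 'rV[R]_n.+1 => F wz.1 wz.2).
  apply/measurable_EFinP; apply: measurable_funM m1E2.
  exact: (measurableT_comp (@measurable_cone_density R n m a) measurable_snd).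
pose N w := (\int[lebesgue_rV n.+1]_z F w z)%E.
have mN : measurable_fun setT N by exact: measurable_integral.
have N0 w : (0 <= N w)%E by exact: integral_ge0.
have mFw w : measurable_fun setT (F w) by exact: (measurableT_comp mF (measurable_pair1 w)).
have NE w : N w = mass (\1_[set z | forall i, I i -> l * gap a i w <= gap a i z]).
  apply: eq_integral => z _; rewrite /F !indicE; congr (_ * _%:R)%:E; congr nat_of_bool.
  apply/idP/idP; rewrite !inE /E2/= => hi i.
    by move=> Ii; have := hi (exist _ i Ii); rewrite !cE mulrN lerN2.
  by rewrite !cE mulrN lerN2; apply: hi; exact: (valP i).
have Nfin w : N w = (fine (N w))%:E.
  rewrite fineK// ge0_fin_numE//; apply: (@le_lt_trans _ _ (mass (fun=> 1))).
    apply: ge0_le_integral => //.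
      by apply/measurable_EFinP; apply: measurable_funM => //; exact: measurable_cone_density.
    move=> z _; rewrite lee_fin ler_wpM2l ?cone_density_ge0//.
  by rewrite massZ ltry.
have mNr : measurable_fun setT (fun w => fine (N w)).
  by apply: (measurableT_comp (f := fine)) => //; exact: fine_measurable.
have Nr0 w : 0 <= fine (N w) by exact: fine_ge0.
have {key} : (((1 - l) ^+ \rank L * (Z * Z))%:E <= mass (fun w => fine (N w)))%E.
  rewrite EFinM EFinM; apply: (le_trans key); apply: lee_of_eq; apply: eq_integral => w _.
  transitivity ((density w)%:E * N w)%E; last by rewrite [in LHS]Nfin -EFinM.
  rewrite -ge0_integralZl//.
pose v w := Z + \sum_(i | I i) M i * expR (- (l * gap a i w)).
have mv i : measurable_fun setT (fun w => M i * expR (- (l * gap a i w))).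
  by apply: measurable_funM.
have msv : measurable_fun setT (fun w => \sum_(i | I i) M i * expR (- (l * gap a i w))).
  by under eq_fun do rewrite -big_filter; exact: measurable_sum.
have v0 i w : 0 <= M i * expR (- (l * gap a i w)) by rewrite mulr_ge0// expR_ge0.
have massv : mass v = (Z * Z + \sum_(i | I i) M i * exp_gap l i)%:E.
  rewrite cone_massD//; last by move=> w _; exact: sumr_ge0.
  rewrite EFinD; congr (_ + _)%E.
    exact: mass_cst.
  rewrite (cone_mass_sum I mv)// -sumEFin; apply: eq_bigr => i _.
  by rewrite cone_massZ// mass_exp_gap// EFinM.
have massS : mass (fun=> \sum_(i | I i) M i) = (Z * \sum_(i | I i) M i)%:E.
  by rewrite mass_cst ?sumr_ge0// mulrC.
(* The thresholds [l * gap a i w] depend on [w] but are constants for the integration over [z]. *)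
have le_v : (mass (fun w => fine (N w) + \sum_(i | I i) M i)%R <= mass v)%E.
  apply: le_cone_mass.
  - exact: measurable_funD.
  - exact: measurable_funD.
  - by move=> w _; rewrite addr_ge0// sumr_ge0.
  move=> w Cw; have c0 i : 0 <= l * gap a i w by rewrite mulr_ge0// gap_ge0.
  have /= := @cone_mass_gap_ge R n m a I (fun i => l * gap a i w) c0.
  rewrite -NE Nfin massZ.
  under eq_bigr do rewrite massM.
  under [in leRHS]eq_bigr do rewrite massM -EFinM.
  rewrite !sumEFin -!EFinD lee_fin => /le_trans; apply.
  by rewrite /v lerD2l; apply: ler_sum => i _; rewrite mulrC.
rewrite cone_massD// in le_v; last by move=> w _; exact: sumr_ge0.
rewrite massS massv in le_v => h1.
have := le_trans (leeD h1 (lexx _)) le_v.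
by rewrite -EFinD lee_fin.
Qed.

Let u (l : R) z := \sum_(i | I i) M i * h l i z.

Let measurable_u l : measurable_fun setT (u l).
Proof.
rewrite /u; under eq_fun do rewrite -big_filter.
by apply: measurable_sum => i; apply: measurable_funM.
Qed.

Let u_ge0 l z : C z -> 0 <= u l z.
Proof. by move=> Cz; apply: sumr_ge0 => i _; rewrite mulr_ge0// h_ge0. Qed.

(** [dyadic_exp] divided by [l]: on the left [1 - e^-y >= y / (1 + y)] with [y = l * gap], on the
    right Bernoulli's inequality. *)
Let mass_u q : (mass (u (2^-1 ^+ q.+1)) <= ((\rank L)%:R * (Z * Z))%:E)%E.
Proof.
set l := 2^-1 ^+ q.+1.
have l0 : 0 < l by rewrite exprn_gt0// invr_gt0.
have l1 : l <= 1 by rewrite exprn_ile1// ?invr_ge0// invf_le1// ler1n.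
have l0' := ltW l0.
have key := @dyadic_exp q l erefl.
have mh i : (mass (h l i) <= (l^-1 * (Z - exp_gap l i))%:E)%E.
  have : (mass (fun z => l * h l i z + expR (- (l * gap a i z)))%R <= mass (fun=> 1%R))%E.
    apply: le_cone_mass => //.
    - by apply: measurable_funD => //; apply: measurable_funM.
    - by move=> z Cz; rewrite addr_ge0 ?expR_ge0// mulr_ge0 ?h_ge0//.
    move=> z Cz; rewrite hE// mulrA addrC.
    by apply: one_sub_expRN; rewrite mulr_ge0 ?gap_ge0//.
  rewrite cone_massD//; last 2 first.
  - by apply: measurable_funM.
  - by move=> z Cz; rewrite mulr_ge0 ?h_ge0//.
  rewrite cone_massZ//; last by move=> z; exact: h_ge0.
  rewrite mass_exp_gap// massZ -leeBrDr// => hle.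
  by rewrite EFinM lee_pdivlMl.
rewrite (cone_mass_sum I (u := fun i z => M i * h l i z)); last 2 first.
- by move=> i; apply: measurable_funM.
- by move=> i z Cz; rewrite mulr_ge0// h_ge0.
have : (\sum_(i | I i) mass (fun z => (M i * h l i z)%R) <=
    \sum_(i | I i) (M i * (l^-1 * (Z - exp_gap l i)))%:E)%E.
  apply: lee_sum => i _; rewrite cone_massZ//; last by move=> z; exact: h_ge0.
  by rewrite EFinM lee_wpmul2l// lee_fin.
move=> /le_trans; apply; rewrite sumEFin lee_fin.
under eq_bigr do rewrite mulrCA mulrBr.
rewrite -mulr_sumr ler_pdivrMl// sumrB -mulr_suml.
have b := bernoulli (\rank L) (ltW l0) l1.
have : (1 - (\rank L)%:R * l) * (Z * Z) <= (1 - l) ^+ \rank L * (Z * Z).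
  by rewrite ler_wpM2r// mulr_ge0.
lra.
Qed.

(** The limit of [mass_u] along [l = 2^-(q+1)], by monotone convergence. *)
Lemma strict_cone_mass_le :
  (mass (fun z => \sum_(i | I i) M i * gap a i z)%R <= ((\rank L)%:R * (Z * Z))%:E)%E.
Proof.
pose l q : R := 2^-1 ^+ q.+1.
have l0 q : 0 < l q by rewrite exprn_gt0// invr_gt0.
have ndl : {homo l : q r / (q <= r)%N >-> r <= q}.
  by move=> q r qr; rewrite /l ler_wiXn2l// ?invr_ge0// invf_le1// ler1n.
have cl : l q @[q --> \oo] --> (0 : R).
  rewrite (_ : l = fun q => 2^-1 * 2^-1 ^+ q); last by apply/funext => q; rewrite /l exprS.
  rewrite -(mulr0 2^-1); apply: cvgMl_tmp; apply: cvg_expr.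
  by rewrite ger0_norm ?invr_ge0// invf_lt1// ltr1n.
pose g q z := (density z * u (l q) z)%:E.
have mg q : measurable_fun setT (g q).
  apply/measurable_EFinP; apply: measurable_funM => //; exact: measurable_cone_density.
have g0 q z : setT z -> (0 <= g q z)%E.
  by move=> _; apply: cone_density_mul_ge0; exact: u_ge0.
have ndg z : setT z -> nondecreasing_seq (g ^~ z).
  move=> _ q r qr; rewrite lee_fin; have [Cz|Cz] := pselect (C z); last first.
    by rewrite cone_density_out// !mul0r.
  rewrite ler_wpM2l ?cone_density_ge0//; apply: ler_sum => i _; rewrite ler_wpM2l//.
  have l1 := ltW (l0 q); have l2 := ltW (l0 r).
  rewrite !hE// ler_wpM2l ?gap_ge0// lef_pV2 ?posrE ?den_gt0//.
  by rewrite lerD2l ler_wpM2r ?gap_ge0// ndl.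
have cv := @cvg_monotone_convergence _ _ _ (lebesgue_rV n.+1) _ measurableT g mg g0 ndg.
have -> : mass (fun z => \sum_(i | I i) M i * gap a i z)%R =
    (\int[lebesgue_rV n.+1]_z limn (g ^~ z))%E.
  apply: eq_integral => z _; apply/esym/cvg_lim => //.
  have [Cz|Cz] := pselect (C z); last first.
    rewrite /g cone_density_out// mul0r; under eq_fun do rewrite mul0r; exact: cvg_cst.
  apply: cvg_EFin; first exact: nearW.
  apply: cvgMl_tmp; apply: cvg_rsum => i _; apply: cvgMl_tmp.
  rewrite (_ : (fun q => _) = fun q => gap a i z / (1 + l q * gap a i z)); last first.
    by apply/funext => q /=; rewrite hE// ltW.
  rewrite -[X in _ --> X]divr1; apply: cvgMl_tmp; apply: cvgV => //.
  rewrite -[X in _ --> X]addr0; apply: cvgD; first exact: cvg_cst.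
  by rewrite -[X in _ --> X](mul0r (gap a i z)); apply: cvgMr_tmp.
rewrite -(cvg_lim _ cv)//; apply: lime_le; first by apply/cvg_ex; eexists; exact: cv.
by apply: nearW => q; exact: mass_u.
Qed.

(** Substitute [Z = n! V], [M i = n! w i] and the mass [(n+1)! V] of [gap], with [V] the volume of
    [P]; then cancel [n! n! V]. *)
Lemma strict_cone_concentration :
  (n.+1%:R%:E * \sum_(i | I i) lebesgue_rV n (strict_cone a i `&` P) <=
   (\rank L)%:R%:E * vol P)%E.
Proof.
have fact0 : (0 : R) < n`!%:R by rewrite ltr0n fact_gt0.
pose V := fine (vol P); have VE : vol P = V%:E.
  by rewrite /V fineK// ge0_fin_numE.
have V0 : 0 <= V by rewrite -lee_fin -VE.
have ZE : Z = n`!%:R * V by apply: EFin_inj; rewrite -massZ cone_mass1 VE EFinM.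
pose w i := n`!%:R^-1 * M i.
have wE i : lebesgue_rV n (strict_cone a i `&` P) = (w i)%:E.
  rewrite EFinM -massM cone_mass_strict_cone muleA -EFinM mulVf ?gt_eqF// mul1e//.
have MwE i : M i = n`!%:R * w i by rewrite /w mulrA divff ?gt_eqF// mul1r.
under eq_bigr do rewrite wE.
rewrite sumEFin VE -!EFinM lee_fin.
have := strict_cone_mass_le.
rewrite (cone_mass_sum I (u := fun i z => M i * gap a i z)); last 2 first.
- by move=> i; apply: measurable_funM => //; exact: measurable_gap.
- by move=> i z Cz; rewrite mulr_ge0// gap_ge0.
under eq_bigr => i _.
  rewrite cone_massZ//; [|exact: measurable_gap|by move=> z; exact: gap_ge0].
  rewrite cone_mass_gapE// VE MwE -!EFinM.
  over.
rewrite sumEFin lee_fin ZE.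
(* For [V = 0] nothing can be cancelled, but both sides vanish. *)
move: V0; rewrite le_eqVlt => /predU1P[V0 _|V0].
  rewrite -V0 mulr0 big1 ?mulr0// => i _; apply/eqP; rewrite eq_le; apply/andP; split.
    have volP0 : vol P = 0%:E by rewrite VE -V0.
    rewrite -lee_fin -wE -volP0; apply: le_measure; rewrite ?inE//.
      apply: measurableI; first exact: measurable_strict_cone.
      exact: measurable_halfspaces.
    exact: measurable_halfspaces.
  by rewrite mulr_ge0// invr_ge0 ltW.
rewrite -mulr_suml -mulr_sumr factS natrM => key.
have c0 : 0 < n`!%:R * (n`!%:R * V) by rewrite !mulr_gt0.
rewrite -(ler_pM2l c0); lra.
Qed.

End strict_cone_concentration.

(** * Polytopes *)

Section polytope.
Context {R : realType}.

Lemma convex_setP (V : lmodType R) (A : set V) : @convex_set R V A <->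
  forall x y (t : R), 0 <= t -> t <= 1 -> A x -> A y -> A (t *: x + (1 - t) *: y).
Proof.
split=> [cA x y t t0 t1 Ax Ay|h x y k]; last first.
  by rewrite !inE => Ax Ay; exact: h.
by have := cA x y (Itv01 t0 t1); rewrite !inE; exact.
Qed.

Context {n : nat}.
Implicit Types (P : set 'rV[R]_n) (x y c : 'rV[R]_n).

Lemma polytope_bounded P : polytope P ->
  exists2 B : R, 0 <= B & forall x, P x -> forall i, `|x ord0 i| <= B.
Proof.
move=> [V /finite_seqP[s ->] ->].
(* A crude bound on the coordinates of all generating points; the box it defines is convex, so it
   contains the hull. *)
pose B : R := \sum_(v <- s) \sum_i `|v ord0 i|.
exists B; first by rewrite sumr_ge0// => v _; rewrite sumr_ge0.
apply: smallest_sub; last first.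
  move=> x /= xs i; rewrite /B (big_rem x)//= (bigD1 i)//= -addrA lerDl.
  by rewrite addr_ge0// sumr_ge0// => v _; rewrite sumr_ge0.
apply/convex_setP => x y t t0 t1 Bx By i; rewrite !mxE.
apply: le_trans (ler_normD _ _) _; rewrite !normrM ger0_norm// (@ger0_norm _ (1 - t)) ?subr_ge0//.
have h1 : t * `|x ord0 i| <= t * B by rewrite ler_wpM2l.
have h2 : (1 - t) * `|y ord0 i| <= (1 - t) * B by rewrite ler_wpM2l// subr_ge0.
lra.
Qed.

Lemma vol_bounded P (B : R) : measurable P ->
  (forall x, P x -> forall i, `|x ord0 i| <= B) -> (vol P < +oo)%E.
Proof.
move=> mP PB.
pose Q : set 'rV[R]_n := [set x | forall i, `[- B, B]%classic (x ord0 i)].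
have mQ : measurable Q by apply: (measurable_rV_box (B := fun=> `[- B, B]%classic)).
apply: (@le_lt_trans _ _ (vol Q)).
  apply: le_measure; rewrite ?inE// => x Px i.
  by rewrite /= in_itv/= -ler_norml; exact: PB.
rewrite /vol (@lebesgue_rV_box _ _ (fun=> `[- B, B]%classic))//.
suff : (\prod_(i < n) lebesgue_measure (`[(- B)%R, B]%classic : set R))%E \is a fin_num.
  by rewrite ltey_eq => ->.
elim/big_ind : _ => [|x y|i _]; [by []|exact: fin_numM|].
by rewrite lebesgue_measure_itv/=; case: ifP.
Qed.

Lemma dotr_norm_le c x (B : R) : (forall i, `|x ord0 i| <= B) ->
  `|dotr c x| <= (\sum_i `|c ord0 i|) * B.
Proof.
move=> xB; rewrite mulr_suml; apply: le_trans (ler_norm_sum _ _ _) _.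
by apply: ler_sum => i _; rewrite normrM ler_wpM2l.
Qed.

Section balanced.
Variables (P : set 'rV[R]_n) (B : R).
Hypotheses (mP : measurable P) (B0 : 0 <= B)
  (PB : forall x, P x -> forall i, `|x ord0 i| <= B).

Let measurable_pos c : measurable_fun P (fun x => (Num.max (dotr c x) 0)%:E).
Proof.
apply/measurable_EFinP/measurable_funTS.
by apply: measurable_maxr => //; exact: measurable_dotr.
Qed.

Lemma integral_pos_part_le c :
  (\int[lebesgue_rV n]_(x in P) (Num.max (dotr c x) 0)%:E <=
   ((\sum_i `|c ord0 i|) * B)%:E * vol P)%E.
Proof.
have K0 : 0 <= (\sum_i `|c ord0 i|) * B by rewrite mulr_ge0// sumr_ge0.
rewrite -integral_cst//; apply: ge0_le_integral => //.
- by move=> x _; rewrite lee_fin le_max lexx orbT.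
- move=> x Px; rewrite lee_fin ge_max K0 andbT.
  exact: le_trans (ler_norm _) (dotr_norm_le _ (PB Px)).
Qed.

Let integrable_bounded (f : 'rV[R]_n -> R) (K : R) : measurable_fun setT f ->
  (forall x, P x -> `|f x| <= K) -> (lebesgue_rV n).-integrable P (EFin \o f).
Proof.
move=> mf fK; apply: measurable_bounded_integrable => //.
- exact: vol_bounded PB.
- exact: measurable_funTS.
- by exists K; split=> [|M KM x Px]; [exact: num_real|exact: le_trans (fK _ Px) (ltW KM)].
Qed.

Lemma dotrN c x : dotr (- c) x = - dotr c x.
Proof. by rewrite -sumrN; apply: eq_bigr => i _; rewrite mxE mulNr. Qed.

(** The vanishing of the integral of [dotr c] over [P], split into positive and negative parts
    because [cone_mass_base] takes nonnegative functions. *)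
Lemma centroid0_balanced c : centroid P = 0 ->
  (\int[lebesgue_rV n]_(x in P) (Num.max (dotr c x) 0)%:E =
   \int[lebesgue_rV n]_(x in P) (Num.max (- dotr c x) 0)%:E)%E.
Proof.
have pos0 (f : 'rV[R]_n -> R) : (0 <= \int[lebesgue_rV n]_(x in P) (Num.max (f x) 0)%:E)%E.
  by apply: integral_ge0 => x _; rewrite lee_fin le_max lexx orbT.
have Pfin : (vol P < +oo)%E by exact: vol_bounded PB.
have posE d : vol P = 0%E -> (\int[lebesgue_rV n]_(x in P) (Num.max (dotr d x) 0)%:E = 0)%E.
  move=> P0; apply/eqP; rewrite eq_le pos0 andbT.
  by have := integral_pos_part_le d; rewrite P0 mule0.
(* For volume [0] the inverse in [centroid] is [0] by default; both integrals are then over a null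
   set. *)
have [P0 _|P0] := eqVneq (vol P) 0%E.
  rewrite posE//; under eq_integral do rewrite -dotrN.
  by rewrite posE.
rewrite /centroid => /eqP; rewrite scaler_eq0 invr_eq0 fine_eq0; last first.
  by rewrite ge0_fin_numE.
rewrite (negPf P0)/= => /eqP row0.
have coord0 i : \int[lebesgue_rV n]_(x in P) x ord0 i = 0.
  by move/rowP : row0 => /(_ i); rewrite !mxE.
have icoord i : (lebesgue_rV n).-integrable P (fun x => (x ord0 i)%:E).
  apply: (integrable_bounded (K := B)); first exact: measurable_coord.
  by move=> x Px; exact: PB.
have icoordZ i : (lebesgue_rV n).-integrable P (fun x => ((c ord0 i)%:E * (x ord0 i)%:E)%E).
  exact: integrableZl.
have : (\int[lebesgue_rV n]_(x in P) (dotr c x)%:E = 0)%E.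
  transitivity (\int[lebesgue_rV n]_(x in P) (\sum_i (c ord0 i)%:E * (x ord0 i)%:E))%E.
    by apply: eq_integral => x _; rewrite -sumEFin.
  rewrite integral_sum// big1// => i _; rewrite integralZl//.
  rewrite -[X in (_ * X)%E]fineK; last exact: integrable_fin_num.
  by have := coord0 i; rewrite /Rintegral => ->; rewrite mule0.
rewrite integralE.
rewrite (_ : (fun x => (dotr c x)%:E)^\+%E = fun x => (Num.max (dotr c x) 0)%:E); last first.
  by apply/funext => x; rewrite funeposE EFin_max.
rewrite (_ : (fun x => (dotr c x)%:E)^\-%E = fun x => (Num.max (- dotr c x) 0)%:E); last first.
  by apply/funext => x; rewrite funenegE EFin_max EFinN.
set p := (\int[_]_(x in P) (Num.max (dotr c x) 0)%:E)%E.
set q := (\int[_]_(x in P) (Num.max (- dotr c x) 0)%:E)%E.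
have fin d : (\int[lebesgue_rV n]_(x in P) (Num.max (dotr d x) 0)%:E)%E \is a fin_num.
  rewrite ge0_fin_numE//; apply: le_lt_trans (integral_pos_part_le d) _.
  by rewrite lte_mul_pinfty// lee_fin mulr_ge0// sumr_ge0.
have pf : p \is a fin_num by exact: fin.
have qf : q \is a fin_num.
  by rewrite /q; under eq_integral do rewrite -dotrN; exact: fin.
by move=> /eqP; rewrite sube_eq// ?add0e => /eqP.
Qed.

End balanced.

End polytope.

(** * The cones over the facets *)

Section cone_of.
Context {R : realType} {n m : nat}.
Variables (P : set 'rV[R]_n) (a : 'I_m -> 'rV[R]_n) (B : R).
Hypotheses (PE : P = halfspaces a) (PB : forall x, P x -> forall i, `|x ord0 i| <= B).

Lemma recession_eq0 x : (forall j, dotr (a j) x <= 0) -> x = 0.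
Proof.
move=> x0; apply/rowP => i; rewrite mxE; apply/eqP; apply: contraT => xi.
have B0 : 0 <= B.
  have : P 0 by rewrite PE => j; rewrite -(scale0r 0) dotrZr mul0r.
  by move=> /PB/(_ i); rewrite mxE normr0.
(* A multiple of [x] that would remain in [P] although its coordinate [i] has absolute value
   [B + 1]. *)
pose s := (B + 1) / `|x ord0 i|.
have xi0 : 0 < `|x ord0 i| by rewrite normr_gt0.
have s0 : 0 <= s by rewrite divr_ge0// addr_ge0.
have : P (s *: x).
  by rewrite PE => j; rewrite dotrZr; apply: (le_trans _ ler01); exact: mulr_ge0_le0.
move=> /PB/(_ i); rewrite mxE normrM ger0_norm// divfK ?gt_eqF//; lra.
Qed.

(** The right-hand side is convex. Conversely, with [s = dotr (a i) x > 0], [x] is the combination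
    of [x / s] in the facet and [0] with weights [s] and [1 - s]; for [s = 0], boundedness of [P]
    forces [x = 0]. *)
Lemma cone_ofE i : cone_of P (a i) =
  [set x | [/\ 0 <= dotr (a i) x, dotr (a i) x <= 1 &
    forall j, dotr (a j) x <= dotr (a i) x]].
Proof.
apply/seteqP; split.
  apply: smallest_sub.
    apply/convex_setP => x y t t0 t1 [x0 x1 xa] [y0 y1 ya].
    have t1' : 0 <= 1 - t by rewrite subr_ge0.
    split; rewrite ?dotrDr ?dotrZr.
    - by rewrite addr_ge0// mulr_ge0.
    - rewrite -[leRHS](subrK t) addrC lerD//; last by rewrite -[leRHS]mulr1 ler_wpM2l.
      by rewrite -[leRHS]mulr1 ler_wpM2l.
    - by move=> j; rewrite !dotrDr !dotrZr lerD// ler_wpM2l.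
  move=> x [->|[Px x1]].
    have d0 j : dotr (a j) 0 = 0 by rewrite -(scale0r 0) dotrZr mul0r.
    by split; rewrite ?d0// => j; rewrite !d0.
  split; rewrite x1// => j; by move: Px; rewrite PE => /(_ j).
move=> x [x0 x1 xa] T [/convex_setP cT FT].
have T0 : T 0 by apply: FT; left.
move: x0; rewrite le_eqVlt => /predU1P[x0|x0].
  by rewrite (recession_eq0 (x := x)) => // j; rewrite x0; exact: xa.
set s := dotr (a i) x in x0 x1 xa *.
have -> : x = s *: (s^-1 *: x) + (1 - s) *: 0.
  by rewrite scaler0 addr0 scalerA divff ?scale1r// gt_eqF.
apply: cT => //; first exact: ltW.
apply: FT; right; split; last by rewrite /= dotrZr mulVf// gt_eqF.
by rewrite PE => j; rewrite dotrZr ler_pdivrMl// mulr1.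
Qed.

(** The strict and weak inequalities differ on finitely many hyperplanes, with normals [a i] and
    [a j - a i], all nonzero and hence of measure [0]. *)
Lemma vol_cone_of_le i : injective a -> a i != 0 ->
  (vol (cone_of P (a i)) <= lebesgue_rV n (strict_cone a i `&` halfspaces a))%E.
Proof.
move=> inja ai0; rewrite cone_ofE.
set S := [set x | _].
pose N := [set x | dotr (a i) x = 0] `|`
  \big[setU/set0]_(j < m | j != i) [set x | dotr (a j - a i) x = 0].
have mS : measurable S.
  have : measurable ([set x | 0 <= dotr (a i) x] `&` [set x | dotr (a i) x <= 1] `&`
      [set x | forall j, dotr (a j) x <= dotr (a i) x]).
    apply: measurableI; first apply: measurableI.
    - exact: (measurable_ler_set (measurable_cst _) (measurable_dotr _)).
    - exact: (measurable_ler_set (measurable_dotr _) (measurable_cst _)).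
    apply: measurable_forall => j.
    exact: (measurable_ler_set (measurable_dotr _) (measurable_dotr _)).
  congr measurable; apply/seteqP; split=> [x [[? ?] ?]|x [? ? ?]]; by split.
have mN : measurable N.
  apply: measurableU; first exact: measurable_hyperplane.
  apply: bigsetU_measurable => j _; exact: measurable_hyperplane.
have N0 : lebesgue_rV n N = 0%E.
  apply: measure_negligible => //; apply: negligibleU.
    apply/negligibleP; first exact: measurable_hyperplane.
    exact: lebesgue_rV_hyperplane.
  elim/big_ind : _ => [||j ji]; [exact: negligible_set0|exact: negligibleU|].
  apply/negligibleP; first exact: measurable_hyperplane.
  by apply: lebesgue_rV_hyperplane; rewrite subr_eq0; apply: contra_neq ji => /inja.
have mSP : measurable (strict_cone a i `&` halfspaces a).
  by apply: measurableI; [exact: measurable_strict_cone|exact: measurable_halfspaces].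
rewrite -[leRHS]adde0 -N0.
apply: le_trans (measureU2 _ mSP mN); apply: le_measure; rewrite ?inE//.
  exact: measurableU.
move=> x [x0 x1 xa].
have [Nx|Nx] := pselect (N x); [by right|left]; split; last first.
  by move=> j; exact: le_trans (xa j) x1.
split=> [|j ji].
  rewrite lt_neqAle x0 andbT eq_sym; apply/eqP => ax; apply: Nx; by left.
rewrite lt_neqAle xa andbT; apply/eqP => ax; apply: Nx; right.
rewrite (bigD1 j)//=; left; rewrite /= dotrDl dotrN ax; lra.
Qed.

End cone_of.

(** The rows are [(-1, v)] and [(0, b)] for [b] in a basis of [U]; the first one accounts for the
    [+ 1] in [dim A + 1]. *)
Lemma lift_affine_submx (R : realType) (n : nat) (v : 'rV[R]_n) (U : {vspace 'rV[R]_n}) :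
  exists2 L : 'M[R]_(1 + \dim U, n.+1), (\rank L <= (\dim U).+1)%N &
    forall u, u \in U -> (rV_cons (- 1, (v + u)%R) <= L)%MS.
Proof.
pose b := \matrix_(i < \dim U) (rV_cons (0, (vbasis U)`_i) : 'rV[R]_n.+1).
exists (col_mx (rV_cons (- 1, v)) b); first exact: rank_leq_row.
move=> u uU.
have -> : rV_cons (- 1, v + u) = rV_cons (- 1, v) + rV_cons (0, u) :> 'rV[R]_n.+1.
  by rewrite rV_consD addr0.
rewrite -addsmxE addmx_sub_adds//.
rewrite (coord_vbasis uU).
have -> : rV_cons (0, \sum_i coord (vbasis U) i u *: (vbasis U)`_i) =
    \sum_i coord (vbasis U) i u *: rV_cons (0, (vbasis U)`_i) :> 'rV[R]_n.+1.
  apply/rowP => j; rewrite summxE; case: (unliftP ord0 j) => [k|] ->.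
    rewrite rV_consS summxE; apply: eq_bigr => i _.
    by rewrite rV_consZ rV_consS.
  rewrite rV_cons0; apply/esym/big1 => i _.
  by rewrite rV_consZ rV_cons0/= mulr0.
apply: summx_sub => i _; apply: scalemx_sub.
by rewrite -(rowK (fun i => rV_cons (0, (vbasis U)`_i)) i) row_sub.
Qed.

Theorem theorem1p1 (R : realType) (n m : nat) (P : set 'rV[R]_n)
    (a : 'I_m -> 'rV[R]_n) (A : set 'rV[R]_n) :
  polytope P -> affine_dim P = n%:Z -> centroid P = 0 ->
  irredundant_description P a ->
  affine_subspace A ->
  (\sum_(i < m | a i \in A) vol (cone_of P (a i)) <=
   ((affine_dim A + 1)%:~R / (n + 1)%:R)%:E * vol P)%E.
Proof.
move=> polP _ cP [a0 inja PE _] [->|[v [U AE]]].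
  (* For empty [A] the convention [dim A = -1] makes the right-hand side [0], matching the empty
     sum. *)
  rewrite affine_dim0 addNr mul0r mul0e big1// => i.
  by rewrite inE.
rewrite AE affine_dim_translate.
have [B B0 PB] := polytope_bounded polP.
have mP : measurable P by rewrite PE; exact: measurable_halfspaces.
have Pfin : (vol P < +oo)%E by exact: vol_bounded PB.
have [L rL aL] := lift_affine_submx v U.
pose I : pred 'I_m := [pred i | a i \in A].
have IL i : I i -> (rV_cons (- 1, a i) <= L)%MS.
  by rewrite /I inE/= inE AE => -[u uU <-]; exact: aL.
have bal i : (\int[lebesgue_rV n]_(x in halfspaces a) (Num.max (dotr (a i) x) 0)%:E =
    \int[lebesgue_rV n]_(x in halfspaces a) (Num.max (- dotr (a i) x) 0)%:E)%E.
  by rewrite -PE; exact: (centroid0_balanced mP B0 PB).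
have balfin i : (\int[lebesgue_rV n]_(x in halfspaces a) (Num.max (dotr (a i) x) 0)%:E < +oo)%E.
  rewrite -PE; apply: le_lt_trans (integral_pos_part_le mP B0 PB _) _.
  by rewrite lte_mul_pinfty// lee_fin mulr_ge0// sumr_ge0.
have Pfin' : (vol (halfspaces a) < +oo)%E by rewrite -PE.
have := strict_cone_concentration Pfin' IL bal balfin; rewrite -PE => key.
apply: (@le_trans _ _ (\sum_(i | I i) lebesgue_rV n (strict_cone a i `&` P))%E).
  rewrite /I AE; apply: lee_sum => i _.
  by rewrite [X in (_ `&` X)]PE; exact: (vol_cone_of_le PE PB).
rewrite mulrC EFinM -muleA lee_pdivlMl ?ltr0n ?addn1//.
apply: le_trans key _; apply: lee_wpmul2r => //.
by rewrite lee_fin intrD -pmulrn natr1 ler_nat.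
Qed.
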